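(* Let $G$ be a compact Lie group and let $X$ be a compact $G$-ANR on which $G$ acts freely. Then $TC(X/G)=TC^G(X)$.
   Context: A $G$-ANR is a metrizable $G$-space which is an equivariant neighbourhood retract of every metrizable $G$-space containing it as a closed $G$-invariant subspace. Lusternik-Schnirelmann category relative to a subset: for a group $K$, a $K$-space $Z$ and a closed $K$-invariant subset $A\subseteq Z$, an open $K$-invariant subset $U\subseteq Z$ is $K$-compressible into $A$ if the inclusion $U\subseteq Z$ is $K$-homotopic (as maps $U\to Z$) to a $K$-map $c\colon U\to Z$ with $c(U)\subseteq A$. The number ${}_A\mathrm{cat}_K(Z)$ is the least $n$ such that $Z$ is covered by $n$ open $K$-invariant subsets $U_1,\dots,U_n$, each $K$-compressible into $A$ ($\infty$ if there is no such $n$). Invariant topological complexity: for a $G$-space $X$, regard $X\times X$ as a $G\times G$-space via $(g_1,g_2)(x_1,x_2)=(g_1x_1,g_2x_2)$, let $\Delta(X)\subseteq X\times X$ be the diagonal and $\daleth(X):=(G\times G)\cdot\Delta(X)$. Then $TC^G(X):={}_{\daleth(X)}\mathrm{cat}_{G\times G}(X\times X)$. Topological complexity: for a space $Y$, $TC(Y)$ is the least $n$ such that $Y\times Y$ is covered by $n$ open sets $U_i$, each admitting a continuous $s_i\colon U_i\to PY$ with $\pi\circ s_i$ equal to the inclusion $U_i\subseteq Y\times Y$, where $PY$ is the space of paths $[0,1]\to Y$ (compact-open topology) and $\pi(\gamma)=(\gamma(0),\gamma(1))$. (So $TC$ of a point is $1$.) *)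

(* Defs.v *)
From HB Require Import structures.
From mathcomp Require Import all_boot all_order all_algebra generic_quotient.
From mathcomp Require Import all_classical all_reals all_analysis.

Set Implicit Arguments.
Unset Strict Implicit.
Unset Printing Implicit Defensive.

Import Order.TTheory GRing.Theory Num.Theory.
Import numFieldNormedType.Exports.

Local Open Scope quotient_scope.
Local Open Scope classical_set_scope.
Local Open Scope ring_scope.

Lemma continuous_pair2 (A B C D E F : topologicalType)
    (f : A * B -> C) (g : D * E -> F) :
  continuous f -> continuous g ->
  continuous (fun p : (A * D) * (B * E) =>
    (f (p.1.1, p.2.1), g (p.1.2, p.2.2))).
Proof.
move=> cf cg [[a d] [b e]]; apply: cvg_pair => /=.
- apply: (cvg_comp (fun p : (A * D) * (B * E) => (p.1.1, p.2.1)) f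
    _ (cf (a, b))).
  apply: cvg_pair => /=.
  + by apply: (cvg_comp fst fst cvg_fst); exact: cvg_fst.
  + by apply: (cvg_comp snd fst cvg_snd); exact: cvg_fst.
- apply: (cvg_comp (fun p : (A * D) * (B * E) => (p.1.2, p.2.2)) g
    _ (cg (d, e))).
  apply: cvg_pair => /=.
  + by apply: (cvg_comp fst snd cvg_fst); exact: cvg_snd.
  + by apply: (cvg_comp snd snd cvg_snd); exact: cvg_snd.
Qed.

HB.mixin Record isTopologicalGroup G of Group G & Topological G := {
  topgroup_mul_continuous : continuous (fun p : G * G => (p.1 * p.2)%g);
  topgroup_inv_continuous : continuous (fun g : G => (g^-1)%g)
}.

#[short(type="topGroupType")]
HB.structure Definition TopologicalGroup :=
  {G of Group G & Topological G & isTopologicalGroup G}.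

Section prod_topgroup.
Variables G H : topGroupType.

Lemma prod_topgroup_mul_continuous :
  continuous (fun p : (G * H) * (G * H) => (p.1 * p.2)%g).
Proof.
exact: (continuous_pair2 (@topgroup_mul_continuous G)
  (@topgroup_mul_continuous H)).
Qed.

Lemma prod_topgroup_inv_continuous :
  continuous (fun p : G * H => (p^-1)%g).
Proof.
move=> [a b] /=.
apply: cvg_pair => /=.
- by apply: (cvg_comp fst _ cvg_fst); exact: topgroup_inv_continuous.
- by apply: (cvg_comp snd _ cvg_snd); exact: topgroup_inv_continuous.
Qed.

HB.instance Definition _ := isTopologicalGroup.Build (G * H)%type
  prod_topgroup_mul_continuous prod_topgroup_inv_continuous.

End prod_topgroup.

(* C^k and C^oo maps on an open subset D of a normed space.  'D_v f is only
   meaningful on D, and only its values on D are constrained. *)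
Fixpoint Ck_on (R : realType) (V W : normedModType R) (k : nat)
    (D : set V) (f : V -> W) : Prop :=
  if k is k'.+1 then
    (forall x, D x -> differentiable f x) /\
    (forall v, Ck_on k' D ('D_v f))
  else forall x, D x -> {for x, continuous f}.

Definition smooth_on (R : realType) (V W : normedModType R)
    (D : set V) (f : V -> W) : Prop :=
  forall k, Ck_on k D f.

(* [chart_inv] is total; only its values on [chart_im] are meaningful. *)
Record chart (R : realType) (T : topologicalType) (n : nat) := Chart {
  chart_dom : set T;
  chart_map : T -> 'rV[R]_n;
  chart_inv : 'rV[R]_n -> T
}.

Definition chart_im (R : realType) (T : topologicalType) (n : nat)
    (c : chart R T n) : set 'rV[R]_n :=
  chart_map c @` chart_dom c.

Definition is_chart (R : realType) (T : topologicalType) (n : nat)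
    (c : chart R T n) : Prop :=
  [/\ open (chart_dom c), open (chart_im c),
      forall x, chart_dom c x -> chart_inv c (chart_map c x) = x,
      {within chart_dom c, continuous (chart_map c)} &
      {within chart_im c, continuous (chart_inv c)}].

Definition smooth_atlas (R : realType) (T : topologicalType) (n : nat)
    (A : set (chart R T n)) : Prop :=
  [/\ forall c, A c -> is_chart c,
      forall x, exists2 c, A c & chart_dom c x &
      forall c d, A c -> A d ->
        smooth_on (chart_map c @` (chart_dom c `&` chart_dom d))
                  (chart_map d \o chart_inv c)].

Definition smooth_mul (R : realType) (G : topGroupType) (n : nat)
    (A : set (chart R G n)) : Prop :=
  forall c d e, A c -> A d -> A e ->
    smooth_on
      [set p : 'rV[R]_n * 'rV[R]_n |
        [/\ chart_im c p.1, chart_im d p.2 &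
            chart_dom e (chart_inv c p.1 * chart_inv d p.2)%g]]
      (fun p => chart_map e (chart_inv c p.1 * chart_inv d p.2)%g).

Definition smooth_inv (R : realType) (G : topGroupType) (n : nat)
    (A : set (chart R G n)) : Prop :=
  forall c d, A c -> A d ->
    smooth_on
      [set u : 'rV[R]_n | chart_im c u /\ chart_dom d ((chart_inv c u)^-1)%g]
      (fun u => chart_map d ((chart_inv c u)^-1)%g).

Definition lie_group (R : realType) (G : topGroupType) : Prop :=
  [/\ hausdorff_space G, @second_countable G &
      exists (n : nat) (A : set (chart R G n)),
        [/\ smooth_atlas A, smooth_mul A & smooth_inv A]].

Definition compact_lie_group (R : realType) (G : topGroupType) : Prop :=
  compact [set: G] /\ lie_group R G.

Record gspace (G : topGroupType) := GSpace {
  gspace_sort :> topologicalType;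
  act : G -> gspace_sort -> gspace_sort;
  act1 : forall x, act 1%g x = x;
  actM : forall g h x, act (g * h)%g x = act g (act h x);
  act_continuous :
    continuous (fun p : G * gspace_sort => act p.1 p.2)
}.

Definition free_action (G : topGroupType) (X : gspace G) : Prop :=
  forall (g : G) (x : X), act g x = x -> g = 1%g.

Definition invariant_set (G : topGroupType) (X : gspace G) (A : set X) : Prop :=
  forall (g : G) (x : X), A x -> A (act g x).

Definition saturation (G : topGroupType) (X : gspace G) (A : set X) : set X :=
  [set x | exists g : G, exists2 a, A a & x = act g a].

Definition equivariant_on (G : topGroupType) (X Y : gspace G) (U : set X)
    (f : X -> Y) : Prop :=
  forall (g : G) (x : X), U x -> f (act g x) = act g (f x).

Definition metrizable (R : realType) (T : topologicalType) : Prop :=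
  exists d : T -> T -> R,
    [/\ forall x y, d x y = 0 <-> x = y,
        forall x y, d x y = d y x,
        forall x y z, d x z <= d x y + d y z &
        forall x, nbhs x = nbhs_ball_ (fun y e => [set z | d y z < e]) x].

(* A continuous injective closed map is the same thing as a homeomorphism onto
   a closed subspace.  The retraction is taken as a self-map r of Z with
   r(U) = j(X), so that the definition is also correct for empty X. *)
Definition is_GANR (R : realType) (G : topGroupType) (X : gspace G) : Prop :=
  metrizable R X /\
  forall (Z : gspace G) (j : X -> Z),
    metrizable R Z ->
    continuous j -> injective j ->
    (forall A : set X, closed A -> closed (j @` A)) ->
    equivariant_on [set: X] j ->
    exists U : set Z,
      [/\ open U, invariant_set U, range j `<=` U &
          exists r : Z -> Z,
            [/\ {within U, continuous r}, equivariant_on U r,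
                r @` U `<=` range j & forall x, r (j x) = j x]].

Section orbit_space.
Variables (G : topGroupType) (X : gspace G).

Definition orbit_rel (x y : X) : bool := `[< exists g : G, act g x = y >].

Lemma orbit_rel_refl : reflexive orbit_rel.
Proof. by move=> x; apply/asboolP; exists 1%g; rewrite act1. Qed.

Lemma orbit_rel_sym : symmetric orbit_rel.
Proof.
have sub x y : orbit_rel x y -> orbit_rel y x.
  move=> /asboolP[g <-]; apply/asboolP; exists (g^-1)%g.
  by rewrite -actM mulVg act1.
by move=> x y; apply/idP/idP; exact: sub.
Qed.

Lemma orbit_rel_trans : transitive orbit_rel.
Proof.
move=> y x z /asboolP[g <-] /asboolP[h <-]; apply/asboolP.
by exists (h * g)%g; rewrite actM.
Qed.

Canonical orbit_equiv := EquivRel orbit_rel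
  orbit_rel_refl orbit_rel_sym orbit_rel_trans.

Definition orbit_space : topologicalType :=
  quotient_topology {eq_quot orbit_equiv}.

End orbit_space.

Section square.
Variables (G : topGroupType) (X : gspace G).

Definition sq_act (g : G * G) (x : X * X) : X * X :=
  (act g.1 x.1, act g.2 x.2).

Lemma sq_act1 x : sq_act 1%g x = x.
Proof. by case: x => x y; rewrite /sq_act /= !act1. Qed.

Lemma sq_actM g h x : sq_act (g * h)%g x = sq_act g (sq_act h x).
Proof. by rewrite /sq_act /= !actM. Qed.

Lemma sq_act_continuous :
  continuous (fun p : (G * G) * (X * X) => sq_act p.1 p.2).
Proof.
exact: (continuous_pair2 (@act_continuous G X) (@act_continuous G X)).
Qed.

Definition sq_gspace : gspace (G * G)%type :=
  GSpace sq_act1 sq_actM sq_act_continuous.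

End square.

Definition unit_interval (R : realType) : set R := `[0, 1].
Arguments unit_interval : clear implicits.

Definition I_type (R : realType) : topologicalType :=
  set_type (unit_interval R).

Lemma unit_interval0 (R : realType) : 0 \in unit_interval R.
Proof. by apply/mem_set; rewrite /unit_interval /= in_itv /= lexx ler01. Qed.

Lemma unit_interval1 (R : realType) : 1 \in unit_interval R.
Proof. by apply/mem_set; rewrite /unit_interval /= in_itv /= lexx ler01. Qed.

Definition I0 (R : realType) : I_type R := exist _ 0 (unit_interval0 R).
Definition I1 (R : realType) : I_type R := exist _ 1 (unit_interval1 R).

Definition least (P : set nat) : \bar nat :=
  match pselect (exists n, `[< P n >]) with
  | left exP => (ex_minn exP)%:E
  | right _ => +oo%E
  end.

Definition G_homotopic_on (R : realType) (K : topGroupType) (Z W : gspace K)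
    (U : set Z) (f g : Z -> W) : Prop :=
  exists H : Z * I_type R -> W,
    [/\ {within U `*` [set: I_type R], continuous H},
        forall z, U z -> H (z, I0 R) = f z,
        forall z, U z -> H (z, I1 R) = g z &
        forall t, equivariant_on U (fun z => H (z, t))].

Definition compressible (R : realType) (K : topGroupType) (Z : gspace K)
    (A U : set Z) : Prop :=
  exists c : Z -> Z,
    [/\ {within U, continuous c}, equivariant_on U c, c @` U `<=` A &
        G_homotopic_on R U id c].

Definition rel_cat (R : realType) (K : topGroupType) (Z : gspace K)
    (A : set Z) : \bar nat :=
  least [set n | exists U : 'I_n -> set Z,
    \bigcup_i U i = [set: Z] /\
    forall i, [/\ open (U i), invariant_set (U i) & compressible R A (U i)]].

Definition daleth (G : topGroupType) (X : gspace G) : set (sq_gspace X) :=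
  saturation [set p : sq_gspace X | p.1 = p.2].
Arguments daleth {G} X.

Definition TC_inv (R : realType) (G : topGroupType) (X : gspace G) : \bar nat :=
  rel_cat R (daleth X).

Definition path_space (R : realType) (Y : topologicalType) : topologicalType :=
  initial_topology (fun gamma : continuousType (I_type R) Y =>
    (gamma : {compact-open, I_type R -> Y})).

Definition path_ends (R : realType) (Y : topologicalType)
    (gamma : continuousType (I_type R) Y) : Y * Y :=
  (gamma (I0 R), gamma (I1 R)).

Definition TC (R : realType) (Y : topologicalType) : \bar nat :=
  least [set n | exists U : 'I_n -> set (Y * Y),
    \bigcup_i U i = [set: Y * Y] /\
    forall i, open (U i) /\
      exists s : Y * Y -> path_space R Y,
        {within U i, continuous s} /\
        forall p, U i p -> path_ends (s p) = p].

(* Main.v *)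
(* A motion planner on an open set U of X/G x X/G is a homotopy in X/G from the
   first projection to the second.  If X -> X/G has the covering homotopy
   property, its first coordinate lifts to a (G x G)-homotopy on the preimage of
   U that compresses this preimage into daleth X; conversely such a compression
   descends to a homotopy of U into the diagonal, and running its first
   coordinate forwards and then its second one backwards is a motion planner.
   Both constructions keep the number of sets (after shrinking the cover, which
   is possible because X/G is compact Hausdorff).

   The covering homotopy property rests on Gleason's theorem that a free action
   of a compact Lie group is locally trivial.  Neither Haar measure nor
   representations are needed: near the orbit of x0, map x to the Chebyshev
   centre (minimal enclosing ball, with a penalty) of those g for which g x0 is
   close to x.  Squared chart distance to 1 is strongly convex along left
   translations near 1, hence so is a supremum of its translates, and the centre
   is unique and depends on x equivariantly and continuously. *)

Require Import Defs.
From mathcomp Require Import all_boot all_order all_algebra generic_quotient.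
From mathcomp Require Import all_classical all_reals all_analysis.
From mathcomp Require Import ring lra.

Set Implicit Arguments.
Unset Strict Implicit.
Unset Printing Implicit Defensive.

Import Order.TTheory GRing.Theory Num.Theory.
Import numFieldNormedType.Exports.

Local Open Scope quotient_scope.
Local Open Scope classical_set_scope.
Local Open Scope ring_scope.

(** * First and second order mean value estimates along a segment *)

Section segment_calculus.
Variables (R : realType) (V : normedModType R) (n m : nat).
Variables (E : 'I_n -> V) (f : V -> 'rV[R]_m) (A : set V).
Hypothesis df : forall x, A x -> differentiable f x.

Lemma derive_combination (g : V -> 'rV[R]_m) x (w : 'I_n -> R) :
  differentiable g x ->
  'D_(\sum_j w j *: E j) g x = \sum_j w j *: 'D_(E j) g x.
Proof.
move=> dg; rewrite deriveE// linear_sum; apply: eq_bigr => j _.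
by rewrite linearZ/= deriveE.
Qed.

Lemma combinationE (g : V -> 'rV[R]_m) x (w : 'I_n -> R) i :
  differentiable g x ->
  'D_(\sum_j w j *: E j) g x 0 i = \sum_j w j * 'D_(E j) g x 0 i.
Proof.
move=> dg; rewrite derive_combination// summxE.
by apply: eq_bigr => j _; rewrite mxE.
Qed.

Lemma is_derive_segment (g : V -> 'rV[R]_m) p W s i :
  differentiable g (p + s *: W) ->
  is_derive s (1 : R) (fun t : R => g (p + t *: W) 0 i : R)
    ('D_W g (p + s *: W) 0 i).
Proof.
move=> dg.
have dW : derivable g (p + s *: W) W by exact: diff_derivable.
have cv : (fun h : R => h^-1 *: (((fun t : R => g (p + t *: W) 0 i : R)
    \o shift s) (h *: (1 : R)) - g (p + s *: W) 0 i)) @ 0^'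
    --> ('D_W g (p + s *: W) 0 i : R).
  have /= := @cvg_comp _ _ _ _ (fun M : 'rV[R]_m => M 0 i) _ _ _ dW
    (@coord_continuous R 1 m 0 i _).
  apply: cvg_trans; apply: near_eq_cvg; near=> h => /=.
  rewrite !mxE; congr (_ * (g _ 0 i - _)).
  by rewrite [h *: 1]mulr1 scalerDl addrCA.
split; first by apply/cvg_ex; eexists; exact: cv.
exact: cvg_lim cv.
Unshelve. all: by end_near. Qed.

Variables (C om : R).
Hypothesis om0 : 0 <= om.

Lemma combination_bound (w D : 'I_n -> R) K : 0 <= K ->
  (forall j, `|w j| <= om) -> (forall j, `|D j| <= K) ->
  `|\sum_j w j * D j| <= n%:R * om * K.
Proof.
move=> K0 wom DK; rewrite (le_trans (ler_norm_sum _ _ _))//.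
rewrite (@le_trans _ _ (\sum_(j < n) om * K))//; last first.
  by rewrite sumr_const card_ord -[leLHS]mulr_natl mulrA.
by apply: ler_sum => j _; rewrite normrM ler_pM.
Qed.

Lemma lipschitz_segment p (w : 'I_n -> R) i :
  0 <= C ->
  (forall s : R, 0 <= s <= 1 -> A (p + s *: \sum_j w j *: E j)) ->
  (forall j, `|w j| <= om) ->
  (forall x j, A x -> `|'D_(E j) f x 0 i| <= C) ->
  `|f (p + \sum_j w j *: E j) 0 i - f p 0 i| <= n%:R * om * C.
Proof.
set W := \sum_j _ => C0 AW wom DC.
have h1 (s : R) : 0 <= s <= 1 -> is_derive s (1 : R)
    (fun t : R => f (p + t *: W) 0 i : R) ('D_W f (p + s *: W) 0 i).
  by move=> s01; apply/is_derive_segment/df/AW.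
have [||c] := @MVT R (fun t : R => f (p + t *: W) 0 i : R)
  (fun s : R => 'D_W f (p + s *: W) 0 i) 0 1 ltr01.
- by move=> s; rewrite in_itv/= => /andP[s0 s1]; apply: h1; rewrite !ltW.
- apply: derivable_within_continuous => s; rewrite in_itv/= => s01.
  by have [] := h1 _ s01.
rewrite in_itv/= => /andP[/ltW c0 /ltW c1].
rewrite scale0r addr0 scale1r => ->; rewrite subr0 mulr1.
have Ac : A (p + c *: W) by apply: AW; rewrite c0.
rewrite combinationE; last exact: df.
by apply: combination_bound => // j; exact: DC.
Qed.

(** Two applications of the mean value theorem: the even function [h t + h (- t)] on [[0, 1]] has
    slope [h1 c - h1 (- c)] at some [c], and [h1] is then estimated on [[- c, c]]. The length
    [2 * c <= 2] of that interval gives the factor 2. *)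
Lemma second_difference p (w : 'I_n -> R) i :
  0 <= C ->
  (forall j x, A x -> differentiable ('D_(E j) f) x) ->
  (forall s : R, -1 <= s <= 1 -> A (p + s *: \sum_j w j *: E j)) ->
  (forall j, `|w j| <= om) ->
  (forall x j l, A x -> `|'D_(E l) ('D_(E j) f) x 0 i| <= C) ->
  `|f (p + \sum_j w j *: E j) 0 i + f (p - \sum_j w j *: E j) 0 i
    - 2 * f p 0 i| <= 2 * (n%:R * om * (n%:R * om * C)).
Proof.
set W := \sum_j _ => C0 ddf AW wom DC.
pose h (s : R) : R := f (p + s *: W) 0 i.
pose h1 (s : R) : R := \sum_j w j * 'D_(E j) f (p + s *: W) 0 i.
pose h2 (s : R) : R :=
  \sum_j w j * \sum_l w l * 'D_(E l) ('D_(E j) f) (p + s *: W) 0 i.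
have dh (s : R) : -1 <= s <= 1 -> is_derive s (1 : R) h (h1 s).
  move=> s1; have As := AW _ s1.
  by rewrite /h1 -combinationE; [exact/is_derive_segment/df|exact: df].
have dh1 (s : R) : -1 <= s <= 1 -> is_derive s (1 : R) h1 (h2 s).
  move=> s1; have As := AW _ s1.
  have -> : h1 = \sum_j (fun t => w j * 'D_(E j) f (p + t *: W) 0 i).
    by apply/funext => t; rewrite fct_sumE.
  apply: is_derive_sum => j; apply: is_deriveZ.
  by rewrite -combinationE; [exact/is_derive_segment/ddf|exact: ddf].
have dP (s : R) : -1 <= s <= 1 ->
    is_derive s (1 : R) (fun t => h t + h (- t)) (h1 s - h1 (- s)).
  move=> s1; apply: is_deriveD; first exact: dh.
  have s1' : -1 <= - s <= 1 by rewrite lerN2 lerNl andbC.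
  have := @is_derive1_comp R h (fun t => - t) s (h1 (- s)) (- 1) (dh _ s1') _.
  by rewrite mulrN1; apply; exact: is_deriveNid.
have [||c] := @MVT R (fun t => h t + h (- t)) (fun s => h1 s - h1 (- s)) 0 1 ltr01.
- move=> s; rewrite in_itv/= => /andP[s0 s1]; apply: dP.
  by rewrite (ltW s1) andbT; lra.
- apply: derivable_within_continuous => s; rewrite in_itv/= => s01.
  have s1 : -1 <= s <= 1 by lra.
  by have [] := dP _ s1.
rewrite in_itv/= => /andP[c0 c1].
rewrite /h oppr0 scale0r addr0 scaleNr !scale1r addr0 mulr1 => Eh.
have -> : f (p + W) 0 i + f (p - W) 0 i - 2 * f p 0 i = h1 c - h1 (- c).
  by rewrite -Eh; ring.
have cc : - c < c by lra.
have [||e] := @MVT R h1 h2 (- c) c cc.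
- move=> s; rewrite in_itv/= => /andP[s0 s1]; apply: dh1; lra.
- apply: derivable_within_continuous => s; rewrite in_itv/= => s01.
  have s1 : -1 <= s <= 1 by lra.
  by have [] := dh1 _ s1.
rewrite in_itv/= => ee ->.
have Ae : A (p + e *: W) by apply: AW; lra.
rewrite opprK normrM mulrC ler_pM ?normr_ge0//.
  by rewrite ger0_norm; lra.
apply: combination_bound => //; first by rewrite !mulr_ge0.
by move=> j; apply: combination_bound => // l; exact: DC.
Qed.

End segment_calculus.

(** * Uniform estimates for C^2 maps in two vector variables *)

Section C2_estimates.
Variables (R : realType) (n : nat).
Local Notation rV := 'rV[R]_n.

Lemma ler_row_coord (v : rV) i : `|v 0 i| <= `|v|.
Proof.
rewrite [leRHS]/Num.norm/= mx_normrE.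
exact: (le_bigmax _ (fun j => `|v j.1 j.2|) (0, i)).
Qed.

Lemma row_norm_attained (v : rV) : v != 0 -> exists i, `|v| = `|v 0 i|.
Proof.
move=> v0; have /mx_norm_neq0[[i j]] : mx_norm v != 0.
  by apply: contra v0 => /eqP/mx_norm_eq0/eqP.
by rewrite [i]ord1 => ?; exists j.
Qed.

Lemma near_coord_bound (T : topologicalType) (F : T -> rV) x :
  {for x, continuous F} -> \forall y \near x, forall i, `|F y 0 i| <= `|F x| + 1.
Proof.
move=> cF; have /cvgr_dist_lt/(_ _ ltr01) : F y @[y --> x] --> F x by [].
apply: filterS => y Fy i; rewrite (le_trans (ler_row_coord _ _))//.
rewrite -[F y](subKr (F x)) (le_trans (ler_normB _ _))// lerD2l.
exact: ltW.
Qed.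

Lemma ler_sum_term (I : finType) (F : I -> R) i :
  (forall j, 0 <= F j) -> F i <= \sum_j F j.
Proof. by move=> F0; rewrite (bigD1 i)//= lerDl sumr_ge0. Qed.

(** Only the first argument varies, so only the finitely many partial derivatives in the directions
    [E j] matter. Continuity bounds them on a ball around [(p0, p0)], which makes [C] independent of
    the second argument [v]. *)
Lemma C2_estimates (f : rV * rV -> rV) (D : set (rV * rV)) (p0 : rV) :
  Ck_on 2 D f -> nbhs (p0, p0) D ->
  exists r C : R, [/\ 0 < r, 0 <= C &
    forall u u' v, `|p0 - u| < r -> `|p0 - u'| < r -> `|p0 - v| < r ->
    [/\ D (u, v),
        forall i, `|f (u, v) 0 i - f (u', v) 0 i| <= C * `|u - u'| &
        forall i, `|f (u, v) 0 i + f (u', v) 0 i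
                    - 2 * f (2^-1 *: (u + u'), v) 0 i| <= C * `|u - u'| ^+ 2]].
Proof.
move=> [df ddf] nD; pose E (j : 'I_n) : rV * rV := (delta_mx 0 j, 0).
have EE (w : rV) : \sum_j w 0 j *: E j = (w, 0).
  rewrite [RHS]surjective_pairing [LHS]surjective_pairing /=; congr (_, _).
    rewrite (big_morph fst (id1 := 0) (op1 := +%R))//= [RHS]row_sum_delta.
    by apply: eq_bigr.
  rewrite (big_morph snd (id1 := 0) (op1 := +%R))//= big1// => j _.
  exact: scaler0.
have Dp : D (p0, p0) by exact: nbhs_singleton.
pose K1 j : R := `|'D_(E j) f (p0, p0)| + 1.
pose K2 (jl : 'I_n * 'I_n) : R := `|'D_(E jl.2) ('D_(E jl.1) f) (p0, p0)| + 1.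
have K10 j : 0 <= K1 j by rewrite addr_ge0.
have K20 j : 0 <= K2 j by rewrite addr_ge0.
pose C := \sum_j K1 j + \sum_j K2 j.
have C0 : 0 <= C by rewrite addr_ge0// sumr_ge0.
have b1 : \forall x \near (p0, p0), forall j i, `|'D_(E j) f x 0 i| <= C.
  apply: (@filter_forall _ _ (fun j (x : rV * rV) =>
    forall i, `|'D_(E j) f x 0 i| <= C) (nbhs (p0, p0))) => j.
  have [dEj _] := ddf (E j).
  have := near_coord_bound (differentiable_continuous (dEj _ Dp)).
  apply: filterS => x xC i; rewrite (le_trans (xC i))//.
  by rewrite (le_trans (ler_sum_term j K10))// lerDl sumr_ge0.
have b2 : \forall x \near (p0, p0),
    forall j l i, `|'D_(E l) ('D_(E j) f) x 0 i| <= C.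
  apply: (@filter_forall _ _ (fun j (x : rV * rV) =>
    forall l i, `|'D_(E l) ('D_(E j) f) x 0 i| <= C) (nbhs (p0, p0))) => j.
  apply: (@filter_forall _ _ (fun l (x : rV * rV) =>
    forall i, `|'D_(E l) ('D_(E j) f) x 0 i| <= C) (nbhs (p0, p0))) => l.
  have [_ /(_ (E l)) cEjl] := ddf (E j).
  have := near_coord_bound (cEjl _ Dp).
  apply: filterS => x xC i; rewrite (le_trans (xC i))//.
  by rewrite (le_trans (ler_sum_term (j, l) K20))// lerDr sumr_ge0.
have [r /= r0 br] := (@nbhs_ballP R (rV * rV)%type _ _).1
  (filterI nD (filterI b1 b2)).
pose A : set (rV * rV) := ball (p0, p0) r.
have AP u v : A (u, v) <-> `|p0 - u| < r /\ `|p0 - v| < r.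
  have bE (a b : rV) : ball a r b <-> `|a - b| < r by rewrite -ball_normE.
  by split=> -[/bE ? /bE ?].
have dfA x : A x -> differentiable f x by move=> /br[/df].
have conv u u' v t : A (u, v) -> A (u', v) -> 0 <= t <= 1 ->
    A (t *: u + (1 - t) *: u', v).
  move=> /AP[pu pv] /AP[pu' _] t01; apply/AP; split => //.
  have -> : p0 - (t *: u + (1 - t) *: u')
      = t *: (p0 - u) + (1 - t) *: (p0 - u').
    by rewrite !scalerBr addrACA -scalerDl subrKC scale1r opprD.
  rewrite (le_lt_trans (ler_normD _ _))// !normrZ.
  rewrite !ger0_norm; [|lra..].
  have [->|t0] := eqVneq t 0; first by rewrite mul0r add0r subr0 mul1r.
  have tgt : 0 < t by lra.
  have : t * `|p0 - u| < t * r by rewrite ltr_pM2l.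
  have : (1 - t) * `|p0 - u'| <= (1 - t) * r by rewrite ler_wpM2l; lra.
  lra.
(* The first summand serves the Lipschitz bound, the second one the second difference. *)
exists r, (n%:R * C + n%:R * (n%:R * C)); split=> //.
  by rewrite addr_ge0 ?mulr_ge0.
move=> u u' v pu pu' pv.
have Au : A (u, v) by apply/AP.
have Au' : A (u', v) by apply/AP.
have nC : 0 <= n%:R * C by rewrite mulr_ge0.
have nnC : 0 <= n%:R * (n%:R * C) by rewrite mulr_ge0.
split; first by have [] := br _ Au.
- move=> i.
  have uE : (u, v) = (u', v) + \sum_j (u - u') 0 j *: E j.
    by rewrite EE; congr (_, _) => /=; rewrite ?addr0// subrKC.
  suff : `|f (u, v) 0 i - f (u', v) 0 i| <= n%:R * `|u - u'| * C.
    by move=> /le_trans; apply; rewrite mulrAC ler_wpM2r// lerDl.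
  rewrite {1}uE; apply: (lipschitz_segment (A := A)) => //.
  + move=> s s01; rewrite EE.
    have -> : (u', v) + s *: (u - u', 0 : rV) = (s *: u + (1 - s) *: u', v).
      congr (_, _) => /=; last by rewrite scaler0 addr0.
      by rewrite scalerBr scalerBl scale1r addrCA addrA.
    exact: conv.
  + by move=> j; exact: ler_row_coord.
  + by move=> x j /br[_ [+ _]]; exact.
- move=> i; pose w := 2^-1 *: (u - u'); pose q : rV * rV := (2^-1 *: (u + u'), v).
  have uE : (u, v) = q + \sum_j w 0 j *: E j.
    rewrite EE; congr (_, _) => /=; rewrite ?addr0//.
    by apply/rowP => k; rewrite !mxE; field.
  have uE' : (u', v) = q - \sum_j w 0 j *: E j.
    rewrite EE; congr (_, _) => /=; rewrite ?subr0//.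
    by apply/rowP => k; rewrite !mxE; field.
  have w0 : `|w| <= `|u - u'|.
    rewrite normrZ ger0_norm; last lra.
    by rewrite ler_piMl//; lra.
  suff : `|f (u, v) 0 i + f (u', v) 0 i - 2 * f q 0 i|
      <= 2 * (n%:R * `|w| * (n%:R * `|w| * C)).
    move=> /le_trans; apply.
    have -> : 2 * (n%:R * `|w| * (n%:R * `|w| * C))
        = (n%:R * (n%:R * C)) * (2 * `|w| ^+ 2) by ring.
    have w2 : 2 * `|w| ^+ 2 <= `|u - u'| ^+ 2.
      rewrite normrZ ger0_norm; last lra.
      by have := sqr_ge0 `|u - u'|; nra.
    by rewrite (le_trans (ler_wpM2l nnC w2))// ler_wpM2r ?sqr_ge0// lerDr.
  rewrite {1}uE {1}uE'; apply: (second_difference (A := A)) => //.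
  + by move=> j x Ax; have [dEj _] := ddf (E j); apply: dEj; have [] := br _ Ax.
  + move=> s s1; rewrite EE.
    have -> : q + s *: (w, 0 : rV)
        = ((2^-1 * (1 + s)) *: u + (1 - 2^-1 * (1 + s)) *: u', v).
      congr (_, _) => /=; last by rewrite scaler0 addr0.
      by apply/rowP => k; rewrite !mxE; field.
    by apply: conv => //; lra.
  + by move=> j; exact: ler_row_coord.
  + by move=> x j l /br[_ [_ +]]; exact.
Qed.

End C2_estimates.

Lemma near_eq_continuous (T U : topologicalType) (f g : T -> U) x :
  {near x, f =1 g} -> {for x, continuous g} -> {for x, continuous f}.
Proof.
move=> fg; rewrite /prop_for /continuous_at (nbhs_singleton fg).
apply: cvg_trans; apply: near_eq_cvg.
by apply: filterS fg => y ->.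
Qed.

(** * Strict midpoint convexity of the squared Euclidean distance *)

Section square_norm.
Variables (R : realType) (n : nat) (p0 : 'rV[R]_n).

(** The Euclidean distance is used because the norm of ['rV[R]_n] is the sup norm, which is not
    strictly convex. *)
Definition sqdist (x : 'rV[R]_n) : R := \sum_i (x 0 i - p0 0 i) ^+ 2.

Lemma sqdist_ge0 x : 0 <= sqdist x.
Proof. by apply: sumr_ge0 => i _; exact: sqr_ge0. Qed.

Lemma sqdist_self : sqdist p0 = 0.
Proof. by apply: big1 => i _; rewrite subrr expr0n. Qed.

Lemma norm_le_sum_sqr (v : 'rV[R]_n) : `|v| ^+ 2 <= \sum_i (v 0 i) ^+ 2.
Proof.
have [->|/row_norm_attained[i ->]] := eqVneq v 0.
  by rewrite normr0 expr0n sumr_ge0// => i _; exact: sqr_ge0.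
by rewrite real_normK ?num_real// (ler_sum_term i)// => j; exact: sqr_ge0.
Qed.

Lemma norm_le_sqdist x : `|p0 - x| ^+ 2 <= sqdist x.
Proof.
rewrite distrC (le_trans (norm_le_sum_sqr _))//.
by apply: ler_sum => i _; rewrite !mxE.
Qed.

Lemma sqdist_continuous : continuous sqdist.
Proof.
have -> : sqdist = \sum_i (fun x : 'rV[R]_n => (x 0 i - p0 0 i) ^+ 2).
  by apply/funext => x; rewrite fct_sumE.
move=> x; apply: (big_ind (fun F : 'rV[R]_n -> R => {for x, continuous F})).
- exact: (@cst_continuous _ _ (0 : R)).
- by move=> F H cF cH; exact: continuousD.
move=> i _.
apply: (@continuous_comp _ _ _ (fun x : 'rV[R]_n => x 0 i - p0 0 i)
  (fun y => y ^+ 2)); last exact: exprn_continuous.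
by apply: continuousB; [exact: coord_continuous|exact: cst_continuous].
Qed.

(* With [e = a + b - 2 m] the parallelogram law gives, coordinatewise around
   [p0], [a^2 + b^2 - 2 m^2 = (a - b)^2 / 2 + (a + b) e - e^2 / 2]. *)
Lemma sqdist_strict_midpoint (a b m : 'rV[R]_n) (C d eta : R) :
  1 <= C -> 0 < d -> eta <= 1 -> d <= 2 * eta ->
  8 * n.+1%:R * C ^+ 4 * eta <= 1 ->
  `|p0 - a| <= eta -> `|p0 - b| <= eta -> d <= C * `|a - b| ->
  (forall i, `|a 0 i + b 0 i - 2 * m 0 i| <= C * d ^+ 2) ->
  2 * sqdist m < sqdist a + sqdist b.
Proof.
move=> C1 d0 eta1 d2 Ceta pa pb dab me.
have eta0 : 0 < eta by lra.
(* The linear and the quadratic term in the error [e] each cost at most [2 * C ^+ 2 * eta * d ^+ 2],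
   hence the coefficient 4. *)
have key i : (a 0 i - b 0 i) ^+ 2 / 2 - 4 * C ^+ 2 * eta * d ^+ 2 <=
    (a 0 i - p0 0 i) ^+ 2 + (b 0 i - p0 0 i) ^+ 2 - 2 * (m 0 i - p0 0 i) ^+ 2.
  have pai : `|a 0 i - p0 0 i| <= eta.
    by have := ler_row_coord (p0 - a) i; rewrite !mxE distrC; lra.
  have pbi : `|b 0 i - p0 0 i| <= eta.
    by have := ler_row_coord (p0 - b) i; rewrite !mxE distrC; lra.
  have := me i.
  set e := a 0 i + b 0 i - 2 * m 0 i => ei.
  set x := a 0 i - p0 0 i; set y := b 0 i - p0 0 i.
  have -> : m 0 i - p0 0 i = (x + y - e) / 2 by rewrite /x /y /e; field.
  have -> : a 0 i - b 0 i = x - y by rewrite /x /y; ring.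
  have -> : x ^+ 2 + y ^+ 2 - 2 * ((x + y - e) / 2) ^+ 2 =
    (x - y) ^+ 2 / 2 + (x + y) * e - e ^+ 2 / 2 by field.
  suff : `|(x + y) * e| + e ^+ 2 / 2 <= 4 * C ^+ 2 * eta * d ^+ 2.
    by have := ler_norm (- ((x + y) * e)); rewrite normrN; lra.
  have h1 : `|(x + y) * e| <= 2 * eta * (C * d ^+ 2).
    rewrite normrM ler_pM//.
    by rewrite (le_trans (ler_normD _ _))//; rewrite /x /y; lra.
  have h2 : e ^+ 2 <= (C * d ^+ 2) ^+ 2.
    rewrite -(real_normK (num_real e)) ler_sqr ?nnegrE ?normr_ge0//.
    exact: le_trans ei.
  have h3 : (C * d ^+ 2) ^+ 2 <= C ^+ 2 * d ^+ 2 * (4 * eta).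
    have -> : (C * d ^+ 2) ^+ 2 = C ^+ 2 * d ^+ 2 * d ^+ 2 by ring.
    apply: ler_wpM2l; first by rewrite mulr_ge0 ?sqr_ge0.
    by nra.
  have h4 : 2 * eta * (C * d ^+ 2) <= 2 * C ^+ 2 * eta * d ^+ 2.
    have : 0 <= eta * d ^+ 2 by rewrite mulr_ge0 ?sqr_ge0// ltW.
    by nra.
  lra.
have sumkey : (\sum_i (a 0 i - b 0 i) ^+ 2) / 2
    - n%:R * (4 * C ^+ 2 * eta * d ^+ 2) <= sqdist a + sqdist b - 2 * sqdist m.
  rewrite /sqdist mulr_sumr -big_split/= -sumrB mulr_suml.
  rewrite [_ * (4 * _ * _ * _)]mulr_natl.
  rewrite (_ : forall y : R, y *+ n = \sum_(i < n) y); last first.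
    by move=> y; rewrite sumr_const card_ord.
  rewrite -sumrB.
  by apply: ler_sum => i _; exact: key.
have nab : `|a - b| ^+ 2 <= \sum_i (a 0 i - b 0 i) ^+ 2.
  rewrite (le_trans (norm_le_sum_sqr _))//.
  by apply: ler_sum => i _; rewrite !mxE.
rewrite -subr_gt0 (lt_le_trans _ sumkey)// subr_gt0.
rewrite (@lt_le_trans _ _ (`|a - b| ^+ 2 / 2))//; last by lra.
have dab2 : d ^+ 2 <= C ^+ 2 * `|a - b| ^+ 2.
  by rewrite -exprMn ler_sqr// nnegrE ?mulr_ge0//; lra.
have C0 : 0 < C by lra.
rewrite -(ltr_pM2l (exprn_gt0 2 C0)).
rewrite (@lt_le_trans _ _ (d ^+ 2 / 2))//; last by lra.
have -> : C ^+ 2 * (n%:R * (4 * C ^+ 2 * eta * d ^+ 2)) =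
  (8 * n%:R * C ^+ 4 * eta) * (d ^+ 2 / 2) by field.
rewrite -[ltRHS]mul1r ltr_pM2r; last by rewrite divr_gt0// exprn_gt0.
(* The factor [n.+1] in the hypothesis against [n] here makes the inequality strict. *)
apply: lt_le_trans Ceta.
rewrite ltr_pM2r// ltr_pM2r ?exprn_gt0// ltr_pM2l// ltr_nat//.
Qed.

End square_norm.

(** * A midpoint convex function near the identity of a Lie group *)

Section lie_midpoint.
Variables (R : realType) (G : topGroupType).
Hypothesis lieG : lie_group R G.

(* In a chart at [1], squared distance to the origin is strongly midpoint convex
   along left translations, uniformly near [1]; [theta] is its truncation. *)
Lemma lie_midpoint_convex : exists (theta : G -> R) (N : set G),
  [/\ continuous theta, forall g, 0 <= theta g,
      forall g, theta g = 0 <-> g = 1%g, nbhs (1%g : G) N &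
      forall k k', N k -> N k' -> k <> k' -> exists k'', forall g, N g ->
        2 * theta (k'' * g)%g < theta (k * g)%g + theta (k' * g)%g].
Proof.
have [hG _ [n [A [[chA coverA _] smul _]]]] := lieG.
have [c Ac c1] := coverA 1%g.
have [odom oim chiK cchi ciota] := chA _ Ac.
pose chi := chart_map c; pose iota := chart_inv c; pose p0 := chi 1%g.
have imP u : chart_im c u -> chart_dom c (iota u) /\ chi (iota u) = u.
  by move=> [x cx <-]; rewrite /iota chiK.
have imchi g : chart_dom c g -> chart_im c (chi g) by move=> cg; exists g.
have im0 : chart_im c p0 by exact: imchi.
have iota0 : iota p0 = 1%g by rewrite /iota /p0 chiK.
have {cchi} cchi g : chart_dom c g -> {for g, continuous chi}.
  by move: cchi; rewrite continuous_open_subspace// => cchi /mem_set; exact: cchi.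
have {}ciota' u : chart_im c u -> {for u, continuous iota}.
  by move: ciota; rewrite continuous_open_subspace// => ci /mem_set; exact: ci.
have := smul c c c Ac Ac Ac => /(_ 2); set D := [set p | _]; set f := fun p => _.
move=> smf.
have nD : nbhs (p0, p0) D.
  have nim : nbhs p0 (chart_im c) by exact: open_nbhs_nbhs.
  have cmul : {for (p0, p0), continuous
      (fun p : 'rV[R]_n * 'rV[R]_n => (iota p.1 * iota p.2)%g)}.
    apply: (@continuous_comp _ _ _ (fun p : 'rV[R]_n * 'rV[R]_n =>
      (iota p.1, iota p.2)) (fun p : G * G => (p.1 * p.2)%g)); last first.
      exact: topgroup_mul_continuous.
    apply: cvg_pair => /=.
      by apply: (cvg_comp fst iota cvg_fst); exact: ciota'.
    by apply: (cvg_comp snd iota cvg_snd); exact: ciota'.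
  have ndom : nbhs ((iota p0 * iota p0)%g) (chart_dom c).
    by rewrite iota0 mulg1; exact: open_nbhs_nbhs.
  have n1 : \forall p \near (p0, p0), chart_im c p.1.
    exact: (cvg_fst (F := nbhs p0) (G := nbhs p0)).
  have n2 : \forall p \near (p0, p0), chart_im c p.2.
    exact: (cvg_snd (F := nbhs p0) (G := nbhs p0)).
  by near=> p; split; near: p => //; exact: cmul.
have [r [C [r0 C0 est]]] := C2_estimates smf nD.
pose C' := C + 1; have C1 : 1 <= C' by rewrite /C'; lra.
(* [K * eta <= 1] is the smallness condition of [sqdist_strict_midpoint], and [eta <= r] keeps the
   C^2 estimates available. *)
pose K := 8 * n.+1%:R * C' ^+ 4.
have K0 : 0 < K.
  by rewrite /K !mulr_gt0 ?exprn_gt0// ?ltr0n//; lra.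
pose eta := Num.min r (Num.min 1 K^-1).
have eta0 : 0 < eta by rewrite !lt_min r0 ltr01 invr_gt0.
have etar : eta <= r by rewrite ge_min lexx.
have eta1 : eta <= 1 by rewrite !ge_min lexx !orbT.
have etaK : K * eta <= 1.
  by rewrite -ler_pdivlMl// mulr1 !ge_min lexx !orbT.
have [rho rho0 brho] : exists2 rho : R, 0 < rho &
    forall x, `|p0 - x| <= rho -> chart_im c x.
  have nim : nbhs p0 (chart_im c) by exact: open_nbhs_nbhs.
  have [e /= e0 be] := (nbhs_ballP _ _).1 nim.
  exists (e / 2) => [|x px]; first by rewrite divr_gt0.
  by apply: be; rewrite -ball_normE/=; lra.
(* The squared chart distance, cut off at [rho ^+ 2] and extended by that value. Values below the
   cutoff occur only on the chart preimage of the closed [rho]-ball. *)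
pose theta (g : G) : R :=
  if `[< chart_dom c g >] then Num.min (sqdist p0 (chi g)) (rho ^+ 2)
  else rho ^+ 2.
have thetaE g : chart_dom c g ->
    theta g = Num.min (sqdist p0 (chi g)) (rho ^+ 2).
  by move=> cg; rewrite /theta asboolT.
have rho2 : 0 < rho ^+ 2 by rewrite exprn_gt0.
have csq g : chart_dom c g -> {for g, continuous (sqdist p0 \o chi)}.
  move=> cg; apply: continuous_comp; first exact: cchi.
  exact: sqdist_continuous.
(* On [W] the cutoff is inactive and the chart coordinates are [eta]-close to [p0]. *)
pose W := [set g | [/\ chart_dom c g, `|p0 - chi g| < eta &
                      sqdist p0 (chi g) < rho ^+ 2]].
have nW : nbhs (1%g : G) W.
  have ndom : nbhs (1%g : G) (chart_dom c) by exact: open_nbhs_nbhs.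
  have nb : \forall g \near (1%g : G), `|p0 - chi g| < eta.
    by have /cvgr_dist_lt/(_ _ eta0) := cchi _ c1.
  have nq : \forall g \near (1%g : G), sqdist p0 (chi g) < rho ^+ 2.
    apply: (cvgr_lt _ (csq _ c1)).
    by rewrite /= -/p0 sqdist_self.
  by near=> g; split; near: g.
have [[N1 N2]/= [nN1 nN2] N12] : nbhs ((1%g, 1%g) : G * G)
    [set p | W (p.1 * p.2)%g].
  by apply: (@topgroup_mul_continuous G); rewrite /= mulg1.
have nVW : nbhs (1%g : G) [set g | W (g^-1)%g].
  by apply: (@topgroup_inv_continuous G); rewrite /= invg1.
exists theta, (N1 `&` N2 `&` (W `&` [set g | W (g^-1)%g])); split.
- move=> g; have [cg|ncg] := pselect (chart_dom c g).
    apply: (near_eq_continuous (g := fun x =>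
      Num.min (sqdist p0 (chi x)) (rho ^+ 2))).
      have : nbhs g (chart_dom c) by exact: open_nbhs_nbhs.
      by apply: filterS => x; exact: thetaE.
    apply: continuous_min; first exact: csq.
    exact: cvg_cst.
  (* The image of [B] under [iota] is compact, hence closed in the Hausdorff group. It misses [g],
     and off it [theta] is constant. *)
  pose B := [set x | `|p0 - x| <= rho].
  have cB : compact B.
    apply: bounded_closed_compact.
      exists (`|p0| + rho); split; first exact: num_real.
      move=> M pM x px /=; rewrite -[x](subKr p0) (le_trans (ler_normB _ _))//.
      by rewrite /B/= in px; lra.
    rewrite (_ : B = (fun x => `|p0 - x|) @^-1` [set y | y <= rho])//.
    apply: closed_comp; last exact: closed_le.
    move=> x _; apply: continuous_comp; last exact: norm_continuous.
    by apply: continuousB; [exact: cst_continuous|exact: cvg_id].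
  have cK : closed (iota @` B).
    apply: compact_closed => //; apply: continuous_compact => //.
    by apply: continuous_subspaceW ciota => x; exact: brho.
  have nKg : nbhs g (~` (iota @` B)).
    apply: open_nbhs_nbhs; split; first exact: closed_openC.
    by move=> [x Bx xg]; apply: ncg; rewrite -xg; have [] := imP _ (brho _ Bx).
  apply: (near_eq_continuous (g := fun=> rho ^+ 2)); last exact: cst_continuous.
  apply: filterS nKg => x nKx; rewrite /theta; case: asboolP => // cx.
  rewrite min_r// (le_trans _ (norm_le_sqdist _ _))//.
  rewrite ler_sqr ?nnegrE ?normr_ge0 ?(ltW rho0)// leNgt; apply/negP => xB.
  by apply: nKx; exists (chi x); [exact: ltW|exact: chiK].
- by move=> g; rewrite /theta; case: ifP; rewrite ?le_min ?sqdist_ge0 ltW.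
- move=> g; split=> [|->]; last first.
    by rewrite thetaE// -/p0 sqdist_self min_l// ltW.
  rewrite /theta; case: asboolP => [cg|_ /eqP]; last by rewrite gt_eqF.
  rewrite /Num.min; case: ifP => [_ q0|_ /eqP]; last by rewrite gt_eqF.
  have := norm_le_sqdist p0 (chi g); rewrite q0 => n0.
  have : `|p0 - chi g| ^+ 2 == 0 by rewrite eq_le n0 sqr_ge0.
  rewrite sqrf_eq0 normr_eq0 subr_eq0 => /eqP pg.
  by rewrite -[g](chiK _ cg) -/chi -pg.
- by apply: filterI; apply: filterI.
- move=> k k' [[N1k N2k] [Wk Wk']] [[N1k' N2k'] [Wk1 Wk1']] kk'.
  have [ck pk _] := Wk; have [ck' pk' _] := Wk1.
  pose u := chi k; pose u' := chi k'; pose mid := 2^-1 *: (u + u').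
  have pmid : `|p0 - mid| < r.
    have -> : p0 - mid = 2^-1 *: (p0 - u) + 2^-1 *: (p0 - u').
      by apply/rowP => i; rewrite !mxE; field.
    rewrite (le_lt_trans (ler_normD _ _))// !normrZ ger0_norm; last lra.
    by rewrite /u /u'; lra.
  (* The witness [k''] is the midpoint of [k] and [k'] in the chart. After multiplication by [g] it
     is a midpoint only up to a second-order error, bounded by [em]. *)
  exists (iota mid) => g [[N1g N2g] [[cg pg _] [cg' pg' _]]].
  have [ckg pkg qkg] : W (k * g)%g by apply: (N12 (k, g)).
  have [ck'g pk'g qk'g] : W (k' * g)%g by apply: (N12 (k', g)).
  have fE x y : chart_dom c x -> chart_dom c y -> f (chi x, chi y) = chi (x * y)%g.
    by move=> cx cy; rewrite /f/= !chiK.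
  pose v := chi g.
  have pu : `|p0 - u| < r by rewrite /u; lra.
  have pu' : `|p0 - u'| < r by rewrite /u'; lra.
  have pv : `|p0 - v| < r by rewrite /v; lra.
  have [_ _ em] := est _ _ _ pu pu' pv.
  have [[_ _ Dmid] _ _] := est _ _ _ pmid pu pv.
  rewrite /= /v chiK// in Dmid.
  have fm : f (mid, v) = chi (iota mid * g)%g by rewrite /f/= /v chiK.
  have d0 : 0 < `|u - u'|.
    rewrite normr_gt0 subr_eq0; apply/eqP => uu'; apply: kk'.
    by rewrite -[k](chiK _ ck) -[k'](chiK _ ck') -/chi -/u uu'.
  (* Multiplication by [g] contracts distances by at most the factor [C'], because its inverse,
     multiplication by [g^-1], is Lipschitz. *)
  have dab : `|u - u'| <= C' * `|chi (k * g)%g - chi (k' * g)%g|.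
    have pa : `|p0 - chi (k * g)%g| < r by lra.
    have pb : `|p0 - chi (k' * g)%g| < r by lra.
    have pc : `|p0 - chi (g^-1)%g| < r by lra.
    have [_ + _] := est _ _ _ pa pb pc.
    rewrite !fE// !mulgK => lip.
    have uu'0 : u - u' != 0 by rewrite -normr_gt0.
    have [i ->] := row_norm_attained uu'0.
    have := lip i; rewrite !mxE => /le_trans; apply.
    by rewrite ler_wpM2r// /C'; lra.
  rewrite !(thetaE (_ * _)%g)//.
  rewrite (min_l (ltW qkg)) (min_l (ltW qk'g)).
  (* At the midpoint the cutoff can only lower [theta], so no bound by [rho ^+ 2] is required
     there. *)
  apply: (@le_lt_trans _ _ (2 * sqdist p0 (chi (iota mid * g)%g))).
    by rewrite ler_pM2l// ge_min lexx.
  apply: (@sqdist_strict_midpoint _ _ p0 _ _ _ C' `|u - u'| eta) => //.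
  + rewrite -[u - u'](subrKA p0) (le_trans (ler_normD _ _))//.
    by rewrite [`|u - p0|]distrC /u /u'; lra.
  + exact: ltW.
  + exact: ltW.
  + move=> i; have := em i; rewrite !fE// fm => /le_trans; apply.
    by rewrite ler_wpM2r ?sqr_ge0// /C'; lra.
Unshelve. all: by end_near. Qed.

End lie_midpoint.

(** * Compactness: tube lemma, suprema over a compact factor, finite covers *)

Lemma pair_continuous_at (T U V : topologicalType) (f : T -> U) (g : T -> V) x :
  {for x, continuous f} -> {for x, continuous g} ->
  {for x, continuous (fun t => (f t, g t))}.
Proof. by move=> cf cg; exact: cvg_pair. Qed.

(** The tube lemma in filter form. *)
Lemma compact_near_forall (K A : topologicalType) (a : A)
    (P : A -> K -> Prop) : compact [set: K] ->
  (forall k : K, \forall p \near (a, k), P p.1 p.2) ->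
  \forall a' \near a, forall k, P a' k.
Proof.
move=> /compact_near_coveringP cK nP.
suff h : forall k : K, [set: K] k -> \forall k' \near k & i \near nbhs a, P i k'.
  have := cK _ (nbhs a) P (nbhs_filter a) h.
  by apply: filterS => a' h' k; exact: h'.
move=> k _; have [[U V] [/= Ua Vk] UV] := nP k.
by exists (V, U) => // -[k' a'] [/= Vk' Ua']; exact: (UV (a', k')).
Qed.

(** [F] is the fibrewise maximum. It is lower semicontinuous because the maximiser at [a] still
    competes at nearby points, and upper semicontinuous by the tube lemma. *)
Lemma compact_sup (R : realType) (A K : topologicalType) (k0 : K)
    (f : A * K -> R) : compact [set: K] -> continuous f ->
  exists F : A -> R, [/\ continuous F, forall a k, f (a, k) <= F a &
    forall a, exists k, F a = f (a, k)].
Proof.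
move=> cK cf.
have cfa a : continuous (fun k => f (a, k)).
  move=> k; apply: continuous_comp; last exact: cf.
  by apply: cvg_pair => /=; [exact: cvg_cst|exact: cvg_id].
have cfk k : continuous (fun a => f (a, k)).
  move=> a; apply: continuous_comp; last exact: cf.
  by apply: cvg_pair => /=; [exact: cvg_id|exact: cvg_cst].
have maxk a : exists k, forall k', f (a, k') <= f (a, k).
  have [||k _ kmax] := compact_EVT_max _ cK (f := fun k => f (a, k)).
  - by exists k0.
  - exact/continuous_subspaceT/cfa.
  - by exists k => k'; apply: kmax; exact: mem_setT.
have [m mP] := choice maxk.
exists (fun a => f (a, m a)); split=> // [a|a]; last by exists (m a).
apply/cvgrPdist_lt => e e0; near=> a'.
have lo : f (a, m a) - e < f (a', m a).
  near: a'; apply: (cvgr_gt (f (a, m a))); first exact: cfk.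
  by rewrite ltrBlDr ltrDl.
have hi : forall k, f (a', k) < f (a, m a) + e.
  near: a'; apply: compact_near_forall => // k.
  have ke : f (a, k) < f (a, m a) + e.
    by rewrite (le_lt_trans (mP a k))// ltrDl.
  have : \forall p \near (a, k), f p < f (a, m a) + e.
    exact: (@cvgr_lt _ _ (nbhs (a, k)) (nbhs_filter (a, k)) f _ (cf (a, k)) _ ke).
  by apply: (@filterS _ _ (nbhs_filter (a, k))) => -[a' k'].
have := mP a' (m a); have := hi (m a'); rewrite ltr_norml; lra.
Unshelve. all: by end_near. Qed.

(** Near-covering compactness against the filter on finite lists whose basic sets are the lists
    containing a given one. *)
Lemma compact_finite_cover (B : topologicalType) (O : B -> set B) :
  compact [set: B] -> (forall b, nbhs b (O b)) ->
  exists s : seq B, forall z, exists2 b, b \in s & O b z.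
Proof.
move=> /compact_near_coveringP cB nO.
pose F : set_system (seq B) := filter_from setT
  (fun s : seq B => [set t : seq B | {subset s <= t}]).
have FF : Filter F.
  apply: filter_from_filter; first by exists [::].
  move=> s t _ _; exists (s ++ t) => // r str.
  by split=> x xs; apply: str; rewrite mem_cat xs ?orbT.
pose P (s : seq B) z := exists2 b, b \in s & O b z.
suff h : forall x : B, [set: B] x -> \forall z \near x & s \near F, P s z.
  have [s _ sP] := cB _ F P FF h.
  by exists s => z; exact: sP.
move=> x _; exists (O x, [set t : seq B | {subset [:: x] <= t}]).
  by split=> //=; exists [:: x].
by move=> [z t] [/= Oz xt]; exists x => //; apply: xt; rewrite mem_head.
Qed.

(** * Continuous and invariant separating functions on a metrizable space with group action *)

Section metrizable_space.
Variables (R : realType) (X : topologicalType).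

Lemma metrizable_dist : metrizable R X -> exists d : X * X -> R,
  [/\ continuous d, forall p, 0 <= d p & forall p, d p = 0 <-> p.1 = p.2].
Proof.
move=> [d [d0 dC dD dn]].
have dge0 x y : 0 <= d x y.
  by have := dD x x y; have := dD x y x; rewrite (dC y x) (d0 x x).2//; lra.
exists (fun p => d p.1 p.2); split=> [|p|p]; [|exact: dge0|exact: d0].
move=> [x y].
apply/cvgrPdist_lt => e e0.
have nb z : nbhs z [set z' | d z z' < e / 2].
  by rewrite dn; exists (e / 2) => //=; rewrite divr_gt0.
exists ([set z | d x z < e / 2], [set z | d y z < e / 2]).
  by split; exact: nb.
move=> [x' y'] [/= xx' yy'].
have := dD x x' y; have := dD x' y' y; have := dD x' x y'; have := dD x y y'.
by rewrite (dC x' x) (dC y' y) ltr_norml; lra.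
Qed.

End metrizable_space.

Section gspace_basics.
Variables (G : topGroupType) (X : gspace G).

Lemma act_cancel (g : G) : cancel (@act G X g) (act g^-1%g).
Proof. by move=> x; rewrite -actM mulVg act1. Qed.

Lemma act_continuous2 (T : topologicalType) (a : T -> G) (b : T -> X) t :
  {for t, continuous a} -> {for t, continuous b} ->
  {for t, continuous (fun t => act (a t) (b t))}.
Proof.
move=> ca cb; apply: (@continuous_comp _ _ _ (fun t => (a t, b t))
  (fun p : G * X => act p.1 p.2)); last exact: act_continuous.
exact: cvg_pair.
Qed.

Lemma act_continuousr (g : G) : continuous (@act G X g).
Proof.
by move=> x; apply: act_continuous2; [exact: cst_continuous|exact: cvg_id].
Qed.

Variable R : realType.

(** [D] is the maximum of a metric over all simultaneous translates of the two points, which takes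
    the place of an average over the group. *)
Lemma invariant_dist : compact [set: G] -> metrizable R X ->
  exists D : X * X -> R, [/\ continuous D, forall p, 0 <= D p,
    forall p, D p = 0 <-> p.1 = p.2 &
    forall g x y, D (act g x, act g y) = D (x, y)].
Proof.
move=> cG /metrizable_dist[d [cd d0 dE]].
have [|D [cD Dub Datt]] := @compact_sup R (X * X)%type G 1%g
    (fun q => d (act q.2 q.1.1, act q.2 q.1.2)) cG.
  move=> q; apply: continuous_comp; last exact: cd.
  have cact (pr : X * X -> X) : continuous pr ->
      {for q, continuous (fun t : (X * X) * G => act t.2 (pr t.1))}.
    move=> cpr; apply: act_continuous2; first exact: cvg_snd.
    apply: (@continuous_comp _ _ _ fst pr); first exact: cvg_fst.
    exact: cpr.
  apply: cvg_pair; apply: cact => ?; [exact: cvg_fst|exact: cvg_snd].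
exists D; split=> //.
- by move=> p; have [g ->] := Datt p.
- move=> [x y]; split=> /= [D0|->]; last first.
    by have [g ->] := Datt (y, y); exact/dE.
  apply/(dE (x, y))/le_anti; rewrite d0 andbT -D0.
  by have := Dub (x, y) 1%g; rewrite /= !act1.
- move=> g x y; apply/le_anti/andP; split.
    have [h ->] := Datt (act g x, act g y); rewrite /= -!actM.
    exact: (Dub (x, y)).
  have [h ->] := Datt (x, y); have := Dub (act g x, act g y) (h * g^-1)%g.
  by rewrite /= -!actM -mulgA mulVg mulg1.
Qed.

End gspace_basics.

(** The tube lemma at [e = 0]: near each [k] the alternative persists for all small [e], and
    compactness makes the choice of [e] uniform. *)
Lemma compact_pos_lower (R : realType) (K : topologicalType) (p : K -> R)
    (U : set K) : compact [set: K] -> continuous p ->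
  (forall k, nbhs k U \/ 0 < p k) ->
  exists2 e : R, 0 < e & forall k, U k \/ e < p k.
Proof.
move=> cK cp nU.
have : \forall e \near (0 : R), forall k, U k \/ e < p k.
  apply: compact_near_forall => // k; have [Uk|p0] := nU k.
    exists (setT, U); first by split => //; exact: filterT.
    by move=> [e k'] [_ /= Uk']; left.
  exists ([set e | e < p k / 2], [set k' | p k / 2 < p k']).
    split=> /=; first by apply: lt_nbhsl; rewrite divr_gt0.
    by apply: (cvgr_gt _ (cp k)); lra.
  by move=> [e k'] [/= ? ?]; right; lra.
move=> /nbhs_ballP[e /= e0 eP]; exists (e / 2); first by rewrite divr_gt0.
apply: (eP (e / 2)); rewrite -ball_normE /= sub0r normrN ger0_norm; lra.
Qed.

(** * Local triviality of free actions of compact Lie groups *)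

Section local_triviality.
Variables (R : realType) (G : topGroupType) (X : gspace G).
Hypothesis lieG : compact_lie_group R G.
Hypothesis metX : metrizable R X.
Hypothesis freeX : free_action X.

(* [J (x, c)] measures how badly [c] is centred among the [g] for which
   [g x0] is close to [x]; its minimiser over [c], unique by midpoint
   convexity, is an equivariant choice of such a [g]. *)
Lemma local_equivariant_map (x0 : X) : exists (V : set X) (gam : X -> G),
  [/\ open V, V x0, invariant_set V,
      forall x, V x -> {for x, continuous gam} &
      forall g x, V x -> gam (act g x) = (g * gam x)%g].
Proof.
have [cG lG] := lieG.
have [theta [N [cth th0 thE nN conv]]] := lie_midpoint_convex lG.
have [D [cD D0 DE Dinv]] := invariant_dist cG metX.
have [e e0 eN] : exists2 e : R, 0 < e & forall k, N k \/ e < theta k.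
  apply: compact_pos_lower => // k; have [->|k1] := pselect (k = 1%g).
    by left.
  by right; rewrite lt0r th0 andbT; apply/eqP => /thE.
(* Minimisers [c] will satisfy [theta c^-1 < 3 * eta], which puts [c^-1] in [N]. *)
pose eta := e / 3; have eta0 : 0 < eta by rewrite divr_gt0.
have cDx0 : continuous (fun q : X * G => D (q.1, act q.2 x0)).
  move=> q; apply: continuous_comp; last exact: cD.
  apply: cvg_pair; first exact: cvg_fst.
  by apply: act_continuous2; [exact: cvg_snd|exact: cst_continuous].
have cp : continuous (fun g => D (x0, act g x0)).
  move=> g; apply: (@continuous_comp _ _ _ (fun g => (x0, g)) _ _ _ (cDx0 _)).
  by apply: cvg_pair; [exact: cst_continuous|exact: cvg_id].
(* The stabiliser of [x0] is trivial, so an element moving [x0] by at most [del] is near 1 as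
   measured by [theta]. *)
have [del del0 delP] : exists2 del : R, 0 < del &
    forall g, theta g < eta \/ del < D (x0, act g x0).
  apply: compact_pos_lower => // g; have [->|g1] := pselect (g = 1%g).
    by left; apply: (cvgr_lt _ (cth _)); rewrite (thE _).2.
  right; rewrite lt0r D0 andbT; apply/eqP => /DE/= x0g.
  by apply: g1; apply: (freeX (x := x0)).
have [T Tub] : exists T, forall g, theta g <= T.
  have [||k _ kmax] := compact_EVT_max _ cG (f := theta).
  - by exists 1%g.
  - exact/continuous_subspaceT.
  - by exists (theta k) => g; apply: kmax; exact: mem_setT.
have T0 : 0 <= T by exact: le_trans (th0 1%g) (Tub _).
(* With this weight the penalty of any [g] with [theta g >= eta] exceeds the bound [T] of [theta] by
   a margin. *)
pose M := (T + 3 * eta) / del.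
have M0 : 0 < M by rewrite divr_gt0//; lra.
have Mdel : M * del = T + 3 * eta by rewrite divfK ?gt_eqF.
have MP g : theta g < eta \/ T + 3 * eta < M * D (x0, act g x0).
  by have [|d] := delP g; [left|right; rewrite -Mdel ltr_pM2l].
pose f (q : X * G * G) := theta (q.1.2^-1 * q.2)%g - M * D (q.1.1, act q.2 x0).
have [|J [cJ Jub Jatt]] := @compact_sup R (X * G)%type G 1%g f cG.
  move=> q; apply: (@cvgB _ R^o).
    apply: continuous_comp; last exact: cth.
    apply: (@continuous_comp _ _ _ (fun q : X * G * G => (q.1.2^-1%g, q.2))
      (fun p : G * G => (p.1 * p.2)%g)); last exact: topgroup_mul_continuous.
    apply: cvg_pair; last exact: cvg_snd.
    apply: (@continuous_comp _ _ _ (fun q : X * G * G => q.1.2)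
      (fun g : G => g^-1%g)); last exact: topgroup_inv_continuous.
    by apply: (@continuous_comp _ _ _ fst snd); [exact: cvg_fst|exact: cvg_snd].
  apply: (@continuousM _ _ (cst M)); first exact: cst_continuous.
  apply: (@continuous_comp _ _ _ (fun q : X * G * G => (q.1.1, q.2))
    (fun q : X * G => D (q.1, act q.2 x0))); last exact: cDx0.
  apply: cvg_pair; last exact: cvg_snd.
  by apply: (@continuous_comp _ _ _ fst fst); exact: cvg_fst.
have Jinv_le h x c : J (act h x, (h * c)%g) <= J (x, c).
  have [g ->] := Jatt (act h x, (h * c)%g).
  have := Jub (x, c) (h^-1 * g)%g; rewrite /f/=.
  by rewrite -(Dinv h x) -actM mulVKg invgM mulgA.
have Jinv h x c : J (act h x, (h * c)%g) = J (x, c).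
  apply/le_anti; rewrite Jinv_le/=.
  by have := Jinv_le h^-1%g (act h x) (h * c)%g; rewrite act_cancel mulKg.
have cJx x : continuous (fun c => J (x, c)).
  move=> c; apply: (@continuous_comp _ _ _ (fun c => (x, c)) _ _ _ (cJ _)).
  by apply: cvg_pair; [exact: cst_continuous|exact: cvg_id].
pose ismin x c := forall c', J (x, c) <= J (x, c').
have ismin_act h x c : ismin x c -> ismin (act h x) (h * c)%g.
  by move=> m c'; rewrite Jinv -[c'](mulVKg h) Jinv.
have exmin x : exists c, ismin x c.
  have [||k _ kmin] := compact_EVT_min _ cG (f := fun c => J (x, c)).
  - by exists 1%g.
  - exact/continuous_subspaceT.
  - by exists k => c; apply: kmin; exact: mem_setT.
(* The estimates at [x0], with a margin [eta] given up so that they hold on a neighbourhood. *)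
pose P := [set x | [/\ M * D (x, x0) < eta, J (x, 1%g) < 2 * eta &
  forall g, theta g < eta \/ T + 2 * eta < M * D (x, act g x0)]].
have nP : nbhs x0 P.
  have n1 : \forall x \near x0, M * D (x, x0) < eta.
    have c1 : {for x0, continuous (fun x => M * D (x, x0))}.
      apply: (@continuousM _ _ (cst M)); first exact: cst_continuous.
      apply: continuous_comp; last exact: cD.
      by apply: cvg_pair; [exact: cvg_id|exact: cst_continuous].
    by apply: (cvgr_lt _ c1); rewrite (DE (x0, x0)).2// mulr0.
  have n2 : \forall x \near x0, J (x, 1%g) < 2 * eta.
    have c2 : {for x0, continuous (fun x => J (x, 1%g))}.
      apply: continuous_comp; last exact: cJ.
      by apply: cvg_pair; [exact: cvg_id|exact: cst_continuous].
    apply: (cvgr_lt _ c2); have [g ->] := Jatt (x0, 1%g).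
    rewrite /f/= invg1 mul1g.
    have MD0 : 0 <= M * D (x0, act g x0) by rewrite mulr_ge0// ltW.
    by have := Tub g; have [] := MP g; lra.
  have n3 : \forall x \near x0, forall g,
      theta g < eta \/ T + 2 * eta < M * D (x, act g x0).
    apply: compact_near_forall => // g; have [thg|Mg] := MP g.
      exists (setT, [set g' | theta g' < eta]).
        by split; [exact: filterT|exact: (cvgr_lt _ (cth _))].
      by move=> [x g'] [_ /= ?]; left.
    have c3 : {for (x0, g), continuous
        (fun q : X * G => M * D (q.1, act q.2 x0))}.
      by apply: (@continuousM _ _ (cst M)); [exact: cst_continuous|exact: cDx0].
    have Mg' : T + 2 * eta < M * D (x0, act g x0) by lra.
    have := @cvgr_gt _ _ _ (nbhs_filter (x0, g)) _ _ c3 _ Mg'.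
    by apply: (@filterS _ _ (nbhs_filter (x0, g))) => -[x g'] /= ?; right.
  by near=> x; split; near: x.
have uniq x c c' : P x -> ismin x c -> ismin x c' -> c = c'.
  move=> [xx0 Jx1 far] mc mc'.
  have lowJ k : theta k - eta < J (x, k^-1%g).
    have := Jub (x, k^-1%g) 1%g; rewrite /f/= invgK mulg1 act1; lra.
  have minN k : ismin x k -> N k^-1%g.
    move=> mk; have := lowJ k^-1%g; rewrite invgK => lk.
    have [//|] := eN k^-1%g.
    by have := mk 1%g; rewrite /eta in lk Jx1 *; lra.
  apply: contrapT => cc'.
  have cVc' : c^-1%g <> c'^-1%g by move=> /invg_inj.
  have [k'' k''P] := conv _ _ (minN _ mc) (minN _ mc') cVc'.
  have [g Jg] := Jatt (x, k''^-1%g).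
  have := lowJ k''; have := mc k''^-1%g; have := mc' k''^-1%g.
  have := th0 k''; have := Tub (k'' * g)%g.
  have := Jub (x, c) g; have := Jub (x, c') g.
  rewrite Jg /f/= invgK => J1 J2 Tg t0 m1 m2 lo.
  (* The [g] attaining the supremum at the midpoint is not penalised: otherwise [J] there would be
     below [-2 * eta], against [lowJ]. So [g] lies in [N], and midpoint convexity at this [g] gives
     the midpoint a smaller value than the minimisers. *)
  have Ng : N g.
    have [|] := far g; last by lra.
    by have [//|] := eN g; rewrite /eta; lra.
  have := k''P _ Ng; lra.
pose V := [set x | exists g : G, interior P (act g x)].
(* Translation by [g] moves [x] into [P] and minimisers to minimisers. *)
have uniqV x c c' : V x -> ismin x c -> ismin x c' -> c = c'.
  move=> [g /interior_subset Pgx] mc mc'.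
  by apply: (mulgI g); apply: uniq Pgx _ _; exact: ismin_act.
have [gam gamP] := choice exmin.
exists V, gam; split.
- rewrite (_ : V = \bigcup_g (act g @^-1` (interior P))).
    apply: bigcup_open => g _; apply: open_comp; last exact: open_interior.
    by move=> x _; exact: act_continuousr.
  by apply/seteqP; split=> x [g]; exists g.
- by exists 1%g; rewrite act1; exact: nP.
- by move=> h x [g Pgx]; exists (g * h^-1)%g; rewrite actM act_cancel.
- move=> x Vx O; rewrite nbhsE => -[B [oB Bx] BO].
  (* Outside the neighbourhood [B] of [gam x] every [c] is strictly worse than [gam x], uniformly
     for [y] near [x] by compactness. Hence the minimiser at [y] stays in [B]. *)
  have : \forall y \near x, forall c, B c \/ J (y, gam x) < J (y, c).
    apply: compact_near_forall => // c; have [Bc|nBc] := pselect (B c).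
      exists (setT, B); first by split; [exact: filterT|exact: open_nbhs_nbhs].
      by move=> [y c'] [_ /= ?]; left.
    have Jlt : 0 < J (x, c) - J (x, gam x).
      rewrite subr_gt0 lt_neqAle (gamP x c) andbT; apply/eqP => Je.
      apply: nBc; rewrite -(uniqV x (gam x) c)// => c'.
      by rewrite -Je; exact: gamP.
    have cc : {for (x, c), continuous
        (fun q : X * G => J q - J (q.1, gam x))}.
      apply: continuousB; first exact: cJ.
      apply: (@continuous_comp _ _ _ (fun q : X * G => (q.1, gam x)) J);
        last exact: cJ.
      by apply: cvg_pair; [exact: cvg_fst|exact: cst_continuous].
    have := @cvgr_gt _ _ _ (nbhs_filter (x, c)) _ _ cc _ Jlt.
    apply: (@filterS _ _ (nbhs_filter (x, c))) => -[y c'] /= ?; right.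
    by rewrite -subr_gt0.
  rewrite nbhs_simpl/=; apply: filterS => y yP; apply: BO.
  by have [//|] := yP (gam y); rewrite ltNge (gamP y).
- move=> g x Vx; apply: (@uniqV (act g x)).
  + by case: Vx => h Phx; exists (h * g^-1)%g; rewrite actM act_cancel.
  + exact: gamP.
  + exact/ismin_act/gamP.
Unshelve. all: by end_near. Qed.

End local_triviality.

(** * Separation by continuous real functions *)

(** Implies Hausdorff, passes to products, and can be checked on an orbit space by descending
    invariant functions. *)
Definition real_separated (R : realType) (T : topologicalType) :=
  forall x y : T, x <> y -> exists2 f : T -> R, continuous f & f x <> f y.

Section separation.
Variable R : realType.

Lemma real_separated_hausdorff (T : topologicalType) :
  real_separated R T -> hausdorff_space T.
Proof.
move=> sT x y clxy; apply: contrapT => /sT[f cf]; apply.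
apply: (@Rhausdorff R) => A B nA nB.
have [z [Az Bz]] := clxy _ _ (cf x _ nA) (cf y _ nB).
by exists (f z).
Qed.

Lemma real_separated_prod (T U : topologicalType) :
  real_separated R T -> real_separated R U -> real_separated R (T * U)%type.
Proof.
move=> sT sU [x y] [x' y'] ne.
have [xx'|/sT[f cf fx]] := pselect (x = x').
  have /sU[f cf fy] : y <> y' by move=> yy'; apply: ne; rewrite xx' yy'.
  exists (f \o snd) => // p; apply: continuous_comp; first exact: cvg_snd.
  exact: cf.
exists (f \o fst) => // p; apply: continuous_comp; first exact: cvg_fst.
exact: cf.
Qed.

Lemma urysohn_bump (T : topologicalType) (K U : set T) :
  hausdorff_space T -> compact [set: T] -> closed K -> open U -> K `<=` U ->
  exists f : T -> R, [/\ continuous f, forall z, K z -> f z = 1 &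
    forall z, ~ U z -> f z = 0].
Proof.
move=> hT cT cK oU KU.
have dis : (~` U) `&` K = set0.
  by apply/seteqP; split=> // z [nUz Kz]; exact: nUz (KU _ Kz).
have [f [cf f0 f1 _]] := urysohn_ext_itv (compact_normal hT cT)
  (open_closedC oU) cK dis (@ltr01 R).
exists f; split=> // z Az; [apply: f1|apply: f0]; exact: imageP.
Qed.

End separation.

(** * Topology of the orbit space *)

Section orbit_space_topology.
Variables (G : topGroupType) (X : gspace G).
Local Notation Y := (orbit_space X).

Definition orbit_proj (x : X) : Y := \pi_({eq_quot (orbit_equiv X)}) x.

Lemma orbit_proj_surj (b : Y) : exists x, orbit_proj x = b.
Proof. by exists (repr (b : {eq_quot (orbit_equiv X)})); exact: reprK. Qed.

Lemma orbit_projP (x y : X) :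
  orbit_proj x = orbit_proj y <-> exists g : G, act g x = y.
Proof.
split=> [/eqmodP/asboolP//|xy].
by apply/eqmodP; exact/asboolP.
Qed.

Lemma orbit_proj_act (g : G) (x : X) : orbit_proj (act g x) = orbit_proj x.
Proof. by apply/esym/orbit_projP; exists g. Qed.

Lemma orbit_proj_continuous : continuous orbit_proj.
Proof. exact: pi_continuous. Qed.

Lemma orbit_proj_open (A : set X) : open A -> open (orbit_proj @` A).
Proof.
move=> oA; rewrite /open/= /quotient_open.
rewrite (_ : _ @^-1` _ = \bigcup_g (@act G X g @^-1` A)).
  apply: bigcup_open => g _; apply: open_comp => // x _.
  exact: act_continuousr.
apply/seteqP; split=> [x [y Ay /esym/orbit_projP[g gx]]|x [g _ Agx]].
  by exists g => //=; rewrite gx.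
by exists (act g x) => //; exact: orbit_proj_act.
Qed.

Lemma orbit_proj_nbhs (x : X) (A : set X) :
  nbhs x A -> nbhs (orbit_proj x) (orbit_proj @` A).
Proof.
rewrite nbhsE => -[B [oB Bx] BA]; apply: filterS (image_subset _ BA) _.
by apply: open_nbhs_nbhs; split; [exact: orbit_proj_open|exists x].
Qed.

(** The quotient property at a single point, valid because the projection is open. *)
Lemma orbit_descend_continuous (Z : topologicalType) (f : Y -> Z) (x : X) :
  {for x, continuous (f \o orbit_proj)} -> {for orbit_proj x, continuous f}.
Proof.
move=> cf B /cf nB; have := orbit_proj_nbhs nB.
by apply: filterS => _ [y By <-].
Qed.

(** The separating function is minus the [D]-distance from [x] to the orbit of [z]. It is invariant
    in [z], and by compactness it vanishes only on the orbit of [x]. *)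
Lemma orbit_space_separated (R : realType) :
  compact [set: G] -> metrizable R X -> real_separated R Y.
Proof.
move=> cG mX b b'; have [x <-] := orbit_proj_surj b.
have [y <-] := orbit_proj_surj b' => xy.
have [D [cD D0 DE Dinv]] := invariant_dist cG mX.
have [|F [cF Fub Fatt]] := @compact_sup R X G 1%g
    (fun q => - D (x, act q.2 q.1)) cG.
  move=> q; apply: cvgN; apply: continuous_comp; last exact: cD.
  apply: cvg_pair; first exact: cvg_cst.
  by apply: act_continuous2; [exact: cvg_snd|exact: cvg_fst].
have Fle h z : F (act h z) <= F z.
  by have [g ->] := Fatt (act h z); rewrite /= -actM; exact: Fub.
have Finv h z : F (act h z) = F z.
  apply/le_anti; rewrite Fle/=.
  by have := Fle h^-1%g (act h z); rewrite act_cancel.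
pose f (b : Y) := F (repr (b : {eq_quot (orbit_equiv X)})).
have fE z : f (orbit_proj z) = F z.
  have : orbit_proj (repr (orbit_proj z : {eq_quot (orbit_equiv X)}))
    = orbit_proj z by exact: reprK.
  by rewrite /f => /esym/orbit_projP[g <-]; exact: Finv.
exists f.
  move=> c; have [z <-] := orbit_proj_surj c; apply: orbit_descend_continuous.
  have -> : f \o orbit_proj = F by apply/funext => t; exact: fE.
  exact: cF.
rewrite !fE => Fxy; apply: xy.
have Fx : F x = 0.
  apply/le_anti/andP; split.
    by have [g ->] := Fatt x; rewrite oppr_le0.
  by have := Fub x 1%g; rewrite /= act1 (DE (x, x)).2// oppr0.
have [g gy] := Fatt y; move: gy; rewrite -Fxy Fx => /esym/eqP.
rewrite oppr_eq0 => /eqP/DE/= xgy.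
by apply/esym/orbit_projP; exists g.
Qed.

Lemma compact_orbit_space : compact [set: X] -> compact [set: Y].
Proof.
move=> cX; rewrite (_ : [set: Y] = orbit_proj @` [set: X]).
  apply: continuous_compact => //; apply: continuous_subspaceT.
  exact: orbit_proj_continuous.
by apply/seteqP; split=> // b _; have [x <-] := orbit_proj_surj b; exists x.
Qed.

End orbit_space_topology.

(** * Local sections and moving a lift inside a trivialising set *)

Section lifting.
Variables (R : realType) (G : topGroupType) (X : gspace G).
Hypothesis lieG : compact_lie_group R G.
Hypothesis metX : metrizable R X.
Hypothesis freeX : free_action X.
Local Notation Y := (orbit_space X).
Local Notation pi := (@orbit_proj G X).

(** [act (gam x)^-1 x] is constant on orbits, so it descends to a section picking the point with
    group coordinate 1. *)
Lemma local_section (b0 : Y) :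
  exists (V : set Y) (gam : X -> G) (sig : Y -> X),
  [/\ open V, V b0,
      forall x, V (pi x) -> {for x, continuous gam} &
      forall g x, V (pi x) -> gam (act g x) = (g * gam x)%g] /\
  [/\ forall b, V b -> pi (sig b) = b, forall b, V b -> gam (sig b) = 1%g &
      forall b, V b -> {for b, continuous sig}].
Proof.
have [x0 <-] := orbit_proj_surj b0.
have [V [gam [oV Vx0 invV cgam egam]]] := local_equivariant_map lieG metX freeX x0.
have VE x : (pi @` V) (pi x) -> V x.
  by move=> [y Vy /orbit_projP[g <-]]; exact: invV.
pose rp (b : Y) : X := repr (b : {eq_quot (orbit_equiv X)}).
have rpK b : pi (rp b) = b by exact: reprK.
pose sig b := act (gam (rp b))^-1%g (rp b).
have sigE x : V x -> sig (pi x) = act (gam x)^-1%g x.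
  move=> Vx; have /esym/orbit_projP[g gx] := rpK (pi x).
  rewrite /sig -gx egam// invgM -actM; congr act.
  by rewrite -mulgA mulVg mulg1.
exists (pi @` V), gam, sig; split; split.
- exact: orbit_proj_open.
- by exists x0.
- by move=> x /VE; exact: cgam.
- by move=> g x /VE; exact: egam.
- by move=> b Vb; rewrite /sig orbit_proj_act rpK.
- move=> b Vb; rewrite /sig egam ?mulVg//.
  by apply: VE; rewrite rpK.
- move=> _ [x Vx <-]; apply: orbit_descend_continuous.
  apply: (near_eq_continuous (g := fun x => act (gam x)^-1%g x)).
    have : nbhs x V by exact: open_nbhs_nbhs.
    by apply: filterS => y Vy /=; exact: sigE.
  apply: act_continuous2; last exact: cvg_id.
  apply: (@continuous_comp _ _ _ gam (fun g => g^-1%g)); first exact: cgam.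
  exact: topgroup_inv_continuous.
Qed.

(* [gam] and [sig] trivialise the action over [V]: [act (gam x) (sig b)] is the
   point of the orbit [b] with the same group coordinate as [x]. *)
Lemma relift (S : topologicalType) (phi phi' : S -> Y) (c : S -> X)
    (V : set Y) (gam : X -> G) (sig : Y -> X) (C : set S) :
  open V -> (forall x, V (pi x) -> {for x, continuous gam}) ->
  (forall g x, V (pi x) -> gam (act g x) = (g * gam x)%g) ->
  (forall b, V b -> pi (sig b) = b) -> (forall b, V b -> gam (sig b) = 1%g) ->
  (forall b, V b -> {for b, continuous sig}) ->
  continuous phi -> continuous phi' -> continuous c ->
  (forall s, pi (c s) = phi s) -> closed C ->
  (forall s, ~ C s -> phi s = phi' s) ->
  (forall s, C s -> V (phi s) /\ V (phi' s)) ->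
  exists c' : S -> X, [/\ continuous c', forall s, pi (c' s) = phi' s,
    forall s, phi s = phi' s -> c' s = c s &
    forall s s' g, phi s = phi s' -> phi' s = phi' s' ->
      c s' = act g (c s) -> c' s' = act g (c' s)].
Proof.
move=> oV cgam egam pisig gamsig csig cphi cphi' cc pic clC phiC CV.
pose c' s := if `[< V (phi s) /\ V (phi' s) >]
  then act (gam (c s)) (sig (phi' s)) else c s.
(* If [c s = act g (sig (phi s))] then its group coordinate is [g], so the first branch returns
   [c s]. The branches therefore agree off [C], and [c'] is continuous. *)
have c'E s : phi s = phi' s -> c' s = c s.
  move=> ps; rewrite /c'; case: asboolP => // -[Vs _]; rewrite -ps.
  have /orbit_projP[g <-] : pi (sig (phi s)) = pi (c s) by rewrite pisig.
  by rewrite egam ?pisig// gamsig// mulg1.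
exists c'; split=> //.
- move=> s; have [Cs|nCs] := pselect (C s).
    have [Vs Vs'] := CV _ Cs.
    apply: (near_eq_continuous
      (g := fun s => act (gam (c s)) (sig (phi' s)))).
      have n1 : \forall t \near s, V (phi t).
        by apply: cphi; exact: open_nbhs_nbhs.
      have n2 : \forall t \near s, V (phi' t).
        by apply: cphi'; exact: open_nbhs_nbhs.
      by near=> t; rewrite /c' asboolT//; split; near: t.
    apply: act_continuous2; apply: continuous_comp.
    - exact: cc.
    - by apply: cgam; rewrite pic.
    - exact: cphi'.
    - exact: csig.
  apply: (near_eq_continuous (g := c)); last exact: cc.
  have : nbhs s (~` C) by apply: open_nbhs_nbhs; split => //; exact: closed_openC.
  by apply: filterS => t nCt; exact/c'E/phiC.
- move=> s; rewrite /c'; case: asboolP => [[_ Vs]|nV].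
    by rewrite orbit_proj_act pisig.
  by rewrite pic; apply: phiC => /CV.
- move=> s s' g ps ps' cs; rewrite /c' -ps -ps'; case: asboolP => // -[Vs _].
  by rewrite cs egam ?pic// actM.
Unshelve. all: by end_near. Qed.

End lifting.

(** * Clamping to the unit interval, and transport of lifts along a homotopy *)

Section clamp.
Variable R : realType.

Lemma maxr_continuous (T : topologicalType) (f g : T -> R) :
  continuous f -> continuous g -> continuous (fun z => Num.max (f z) (g z)).
Proof. by move=> cf cg z; exact: (continuous_max (cf z) (cg z)). Qed.

Definition clamp (x : R) : R := Num.max 0 (Num.min 1 x).

Lemma clamp_continuous : continuous clamp.
Proof.
apply: maxr_continuous => x; first exact: cvg_cst.
exact: (continuous_min (@cst_continuous _ _ (1 : R) x) (@cvg_id _ (nbhs x))).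
Qed.

Lemma clamp01 x : 0 <= clamp x <= 1.
Proof. by rewrite /clamp le_max lexx/= ge_max ler01/= ge_min lexx. Qed.

Lemma clamp_id x : 0 <= x <= 1 -> clamp x = x.
Proof. by move=> /andP[x0 x1]; rewrite /clamp min_r// max_r. Qed.

Lemma clamp0 x : x <= 0 -> clamp x = 0.
Proof. by move=> x0; rewrite /clamp max_l// ge_min x0 orbT. Qed.

Lemma clamp1 x : 1 <= x -> clamp x = 1.
Proof. by move=> x1; rewrite /clamp min_l// max_r// ler01. Qed.

End clamp.

Section transport.
Variables (R : realType) (G : topGroupType) (X : gspace G).
Hypothesis lieG : compact_lie_group R G.
Hypothesis metX : metrizable R X.
Hypothesis freeX : free_action X.
Local Notation Y := (orbit_space X).
Local Notation pi := (@orbit_proj G X).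

Variables (S B : topologicalType) (p : S -> B) (h : B * R -> Y) (c0 : S -> X).
Hypothesis hB : hausdorff_space B.
Hypothesis cB : compact [set: B].
Hypothesis cp : continuous p.
Hypothesis ch : continuous h.
Hypothesis cc0 : continuous c0.
Hypothesis c0E : forall s, pi (c0 s) = h (p s, 0).

(** The time [tau] may depend on the base point, so that it can be advanced over one part of [B] at
    a time. The clauses on stationary points and on equivariance are carried along because a
    compression has to start at the identity and be equivariant. *)
Definition lifts_along (tau : B -> R) (c : S -> X) :=
  [/\ continuous c, forall s, pi (c s) = h (p s, tau (p s)),
      forall s, (forall t, h (p s, t) = h (p s, 0)) -> c s = c0 s &
      forall s s' g, p s = p s' -> c0 s' = act g (c0 s) -> c s' = act g (c s)].

(** The time changes only over [f >= 1 / 3], a closed set inside [O]. There both the old and the new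
    time lie between [a] and [b], so [h] stays in [V] and [relift] applies. *)
Lemma lifts_along_bump (a b e t0 : R) (f : B -> R) (m : B -> R)
    (V : set Y) (gam : X -> G) (sig : Y -> X) (O : set B) :
  open V -> (forall x, V (pi x) -> {for x, continuous gam}) ->
  (forall g x, V (pi x) -> gam (act g x) = (g * gam x)%g) ->
  (forall b, V b -> pi (sig b) = b) -> (forall b, V b -> gam (sig b) = 1%g) ->
  (forall b, V b -> {for b, continuous sig}) ->
  continuous f -> continuous m -> (forall z, 0 <= m z <= 1) ->
  (forall z, ~ O z -> f z = 0) ->
  `|t0 - a| < e -> `|t0 - b| < e ->
  (forall z t, O z -> `|t0 - t| < e -> V (h (z, t))) ->
  (exists c, lifts_along (fun z => a + (b - a) * m z) c) ->
  exists c, lifts_along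
    (fun z => a + (b - a) * Num.max (clamp (3 * f z - 1)) (m z)) c.
Proof.
pose u z := clamp (3 * f z - 1).
move=> oV cgam egam pisig gamsig csig cf cm m01 fO ta tb OV.
move=> [c [cc pic cfix cequi]].
have u01 z : 0 <= u z <= 1 by exact: clamp01.
have cu : continuous u.
  move=> z; apply: (@continuous_comp _ _ _ (fun z => 3 * f z - 1));
    last exact: clamp_continuous.
  apply: (@cvgB _ R^o); last exact: cvg_cst.
  by apply: cvgM; [exact: cvg_cst|exact: cf].
have cphi (k : B -> R) : continuous k ->
    continuous (fun s => h (p s, a + (b - a) * k (p s))).
  move=> ck s; apply: (@continuous_comp _ _ _
    (fun s => (p s, a + (b - a) * k (p s))) h); last exact: ch.
  apply: pair_continuous_at; first exact: cp.
  apply: (@cvgD _ R^o); first exact: cvg_cst.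
  apply: cvgM; first exact: cvg_cst.
  by apply: continuous_comp; [exact: cp|exact: ck].
have tin w : 0 <= w <= 1 -> `|t0 - (a + (b - a) * w)| < e.
  move=> w01; have -> : t0 - (a + (b - a) * w) =
    (1 - w) * (t0 - a) + w * (t0 - b) by ring.
  rewrite (le_lt_trans (ler_normD _ _))// !normrM [`|1 - w|]ger0_norm; last lra.
  rewrite [`|w|]ger0_norm; last lra.
  have [->|w0] := eqVneq w 0; first by rewrite mul0r addr0 subr0 mul1r.
  have wgt : 0 < w by lra.
  have : w * `|t0 - b| < w * e by rewrite ltr_pM2l.
  have : (1 - w) * `|t0 - a| <= (1 - w) * e by rewrite ler_wpM2l; lra.
  lra.
pose C := (f \o p) @^-1` [set y | 1 / 3 <= y].
have cmax : continuous (fun z => Num.max (u z) (m z)).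
  exact: maxr_continuous.
have [|||c' [cc' pic' cfix' cequi']] := relift oV cgam egam pisig gamsig csig
  (cphi _ cm) (cphi _ cmax) cc pic (C := C).
- apply: closed_comp; last exact: closed_ge.
  by move=> s _; apply: continuous_comp; [exact: cp|exact: cf].
- move=> s; rewrite /C/= => nC.
  suff -> : Num.max (u (p s)) (m (p s)) = m (p s) by [].
  by apply: max_r; rewrite /u clamp0; [have /andP[] := m01 (p s)|lra].
- move=> s Cs; have Os : O (p s).
    by apply: contrapT => /fO fs; move: Cs; rewrite /C/= fs; lra.
  split; apply: OV => //; apply: tin => //.
  by rewrite le_max ge_max; have /andP[-> ->] := u01 (p s);
    have /andP[_ ->] := m01 (p s).
- exists c'; split=> //.
    by move=> s hs; rewrite cfix' ?cfix// !hs.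
  move=> s s' g ps cs; apply: cequi'; rewrite ?ps//.
  exact: cequi.
Qed.

(** Finitely many bumps cover [B], each supported where [h] stays in a trivialising set for times
    near [t0]. Advancing over one bump after the other turns the time [a] into [b] everywhere. The
    order of [a] and [b] is free. *)
Lemma lifts_along_locally_constant (t0 : R) : exists2 e : R, 0 < e &
  forall a b, `|t0 - a| < e -> `|t0 - b| < e ->
  (exists c, lifts_along (fun=> a) c) -> exists c, lifts_along (fun=> b) c.
Proof.
have loc (z0 : B) : exists W : R * (B -> R),
    [/\ 0 < W.1, continuous W.2, W.2 z0 = 1 &
    exists (Q : set B) (V : set Y) (gam : X -> G) (sig : Y -> X),
      [/\ open V, forall x, V (pi x) -> {for x, continuous gam},
          forall g x, V (pi x) -> gam (act g x) = (g * gam x)%g,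
          forall z, ~ Q z -> W.2 z = 0 &
          forall z t, Q z -> `|t0 - t| < W.1 -> V (h (z, t))] /\
      [/\ forall b, V b -> pi (sig b) = b, forall b, V b -> gam (sig b) = 1%g &
          forall b, V b -> {for b, continuous sig}]].
  have [V [gam [sig [[oV Vb cgam egam] sigP]]]] :=
    local_section lieG metX freeX (h (z0, t0)).
  have [[Q T] [/= nQ nT] QT] : nbhs (z0, t0) (h @^-1` V).
    by apply: ch; exact: open_nbhs_nbhs.
  have [e /= e0 eT] := (nbhs_ballP _ _).1 nT.
  move: nQ; rewrite {1}nbhsE => -[Q' [oQ' Q'z0] Q'Q].
  have [||f [cf f1 f0]] := @urysohn_bump R B [set z0] Q' hB cB _ oQ'.
  - exact/accessible_closed_set1/hausdorff_accessible.
  - by move=> _ ->.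
  exists (e, f); split=> //; first exact: f1.
  exists Q', V, gam, sig; split=> //; split=> // z t Q'z t0t.
  apply: (QT (z, t)); split; first exact: Q'Q.
  by apply: eT; rewrite -ball_normE.
have [W WP] := choice loc.
have nW z : nbhs z [set z' | 2 / 3 <= (W z).2 z'].
  by have [_ cf f1 _] := WP z; apply: (cvgr_ge _ (cf z)); rewrite f1; lra.
have [bs bsP] := compact_finite_cover cB nW.
have [e0 e00 e0le] : exists2 e0 : R, 0 < e0 &
    forall z, z \in bs -> e0 <= (W z).1.
  elim: {bsP} bs => [|z bs [e1 e10 e1P]]; first by exists 1.
  exists (Num.min e1 (W z).1); first by rewrite lt_min e10; have [] := WP z.
  move=> y; rewrite inE => /orP[/eqP->|/e1P ye].
    by rewrite ge_min lexx orbT.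
  by rewrite ge_min ye.
exists e0 => // a b ta tb lifta.
pose u (y z : B) := clamp (3 * (W y).2 z - 1).
(* The fraction of the way from [a] to [b] already covered: 0 for the empty list, 1 everywhere for
   the full list [bs]. *)
pose m (l : seq B) (z : B) := foldr (fun y w => Num.max (u y z) w) 0 l.
have cu y : continuous (u y).
  move=> z; apply: (@continuous_comp _ _ _ (fun z => 3 * (W y).2 z - 1));
    last exact: clamp_continuous.
  apply: (@cvgB _ R^o); last exact: cvg_cst.
  apply: cvgM; first exact: cvg_cst.
  by have [_ cf _ _] := WP y; exact: cf.
have cm l : continuous (m l).
  elim: l => [|y l IH]; last exact: maxr_continuous.
  by move=> z; exact: cvg_cst.
have u01 y z : 0 <= u y z <= 1 by exact: clamp01.
have m01 l z : 0 <= m l z <= 1.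
  elim: l => [|y l IH] /=; first by rewrite lexx ler01.
  by rewrite le_max ge_max; have /andP[-> ->] := u01 y z; have /andP[_ ->] := IH.
have step l : {subset l <= bs} ->
    exists c, lifts_along (fun z => a + (b - a) * m l z) c.
  elim: l => [_|y l IH lbs].
    by rewrite (_ : (fun z => _) = fun=> a)//; apply/funext => z;
      rewrite mulr0 addr0.
  have ley : e0 <= (W y).1 by apply/e0le/lbs; rewrite mem_head.
  have [_ cf _ [Q [V [gam [sig [[oV cgam egam fQ QV] [s1 s2 s3]]]]]]] := WP y.
  apply: (lifts_along_bump (t0 := t0) (e := (W y).1) oV cgam egam s1 s2 s3 cf
    (cm l) (m01 l) fQ (lt_le_trans ta ley) (lt_le_trans tb ley) QV).
  by apply: IH => z zl; apply: lbs; rewrite inE zl orbT.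
have mbs z : m bs z = 1.
  apply/le_anti; have /andP[_ ->]/= := m01 bs z.
  have [y ybs yz] := bsP z.
  have uy : 1 <= u y z by rewrite /u clamp1//; rewrite /= in yz; lra.
  elim: {bsP e0le step} bs ybs => //= y' bs IH; rewrite inE le_max.
  by move=> /orP[/eqP<-|/IH ->]; rewrite ?uy ?orbT.
have := step bs (fun _ => id).
rewrite (_ : (fun z => _) = fun=> b)//; apply/funext => z.
by rewrite mbs mulr1 subrKC.
Qed.

(** The set of constant times that admit a lift contains 0 and is open and closed in the connected
    line, so no subdivision of the time interval is made. *)
Lemma lift_transport : exists c, lifts_along (fun=> 1) c.
Proof.
pose P : set R := [set t | exists c, lifts_along (fun=> t) c].
suff PT : P = setT by have : P 1 by rewrite PT.
have cR : connected [set: R] by apply/connected_intervalP.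
apply: cR; first by exists 0, c0; split.
- exists P; last by rewrite setTI.
  rewrite openE => t Pt; have [e e0 eP] := lifts_along_locally_constant t.
  apply/nbhs_ballP; exists e => //= t'; rewrite -ball_normE/= => tt'.
  by apply: (eP t t') => //; rewrite subrr normr0.
- exists P; last by rewrite setTI.
  move=> t clt; have [e e0 eP] := lifts_along_locally_constant t.
  have [t' [Pt' tt']] := clt _ (nbhsx_ballx t e e0).
  rewrite -ball_normE /= in tt'.
  by apply: (eP t' t) => //; rewrite subrr normr0.
Qed.

End transport.

(** * The unit interval and the exponential law for path spaces *)

Section unit_interval_type.
Variable R : realType.
Local Notation I := (I_type R).

Definition I_val (t : I) : R := set_val t.

Lemma I_val_continuous : continuous I_val.
Proof. exact: initial_continuous. Qed.

Lemma I_val01 (t : I) : 0 <= I_val t <= 1.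
Proof. by have := set_valP t; rewrite /unit_interval/= in_itv. Qed.

Lemma clamp_mem (x : R) : clamp x \in unit_interval R.
Proof. by apply/mem_set; rewrite /unit_interval/= in_itv/= clamp01. Qed.

(** The retraction of the line onto the interval; it lets time formulas be written with real
    numbers. *)
Definition to_I (x : R) : I := exist _ (clamp x) (clamp_mem x).

Lemma I_val_to_I x : I_val (to_I x) = clamp x.
Proof. by []. Qed.

Lemma I_val_inj : injective I_val.
Proof. exact: val_inj. Qed.

Lemma to_I_val (t : I) : to_I (I_val t) = t.
Proof. by apply: I_val_inj; rewrite I_val_to_I clamp_id// I_val01. Qed.

Lemma to_I_continuous : continuous to_I.
Proof. by apply: continuous_comp_initial; exact: clamp_continuous. Qed.

Lemma to_I0 x : x <= 0 -> to_I x = I0 R.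
Proof. by move=> x0; apply: I_val_inj; rewrite I_val_to_I clamp0. Qed.

Lemma to_I1 x : 1 <= x -> to_I x = I1 R.
Proof. by move=> x1; apply: I_val_inj; rewrite I_val_to_I clamp1. Qed.

Lemma I_compact : compact [set: I].
Proof.
rewrite (_ : [set: I] = to_I @` `[0, 1]).
  apply: continuous_compact; last exact: segment_compact.
  exact/continuous_subspaceT/to_I_continuous.
apply/seteqP; split=> // t _; exists (I_val t); last exact: to_I_val.
by rewrite /= in_itv/= I_val01.
Qed.

Lemma I_separated : real_separated R I.
Proof.
move=> s t st; exists I_val; first exact: I_val_continuous.
by move=> /I_val_inj.
Qed.

Lemma I_hausdorff : hausdorff_space I.
Proof. exact: real_separated_hausdorff I_separated. Qed.

Variable Y : topologicalType.

(** Regularity of the compact Hausdorff interval gives a compact neighbourhood of [t0] mapped into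
    the given open set, and this is a compact-open condition on the path. *)
Lemma path_eval_continuous (B : topologicalType) (s : B -> path_space R Y) b0 t0 :
  {for b0, continuous s} ->
  {for (b0, t0), continuous (fun q : B * I => s q.1 q.2)}.
Proof.
move=> cs; pose F b : {compact-open, I -> Y} := s b.
have cF : {for b0, continuous F}.
  by apply: continuous_comp; [exact: cs|exact: initial_continuous].
move=> A; rewrite /= nbhsE => -[Q [oQ Qs] QA].
have nQ : nbhs t0 (s b0 @^-1` Q).
  by apply: (@cts_fun _ _ (s b0 : continuousType I Y)); exact: open_nbhs_nbhs.
have [K nK KQ] := @compact_regular _ t0 _ I_hausdorff I_compact filterT _ nQ.
have nF : nbhs (F b0) [set g | g @` closure K `<=` Q].
  apply: open_nbhs_nbhs; split.
    apply: compact_open_open => //.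
    by apply: (subclosed_compact _ I_compact) => //; exact: closed_closure.
  by move=> _ [t Kt <-]; exact: KQ.
exists (F @^-1` [set g | g @` closure K `<=` Q], K); first by split=> //; exact: cF.
move=> [b t] [/= bK Kt]; apply: QA; apply: bK.
by exists t => //; exact: subset_closure.
Qed.

(** For a compact [K] and an open [P], the condition that [t] avoids [K] or the path at [t] is in
    [P] holds near each [(b0, t)]. The tube lemma makes it uniform in [t]. *)
Lemma path_curry_continuous (B : topologicalType) (s : B -> path_space R Y) b0 :
  (forall t0, {for (b0, t0), continuous (fun q : B * I => s q.1 q.2)}) ->
  {for b0, continuous s}.
Proof.
move=> cs A; rewrite nbhsE => -[_ [[Q oQ <-] /= Qs] QA].
pose F b : {compact-open, I -> Y} := s b.
have cF : F b @[b --> b0] --> F b0.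
  apply/compact_open_cvgP => K P cK oP KP.
  have clK : closed K by exact: compact_closed I_hausdorff cK.
  have : \forall b \near b0, forall t, ~ K t \/ P (s b t).
    apply: compact_near_forall; first exact: I_compact.
    move=> t; have [Kt|nKt] := pselect (K t).
      have : \forall q \near (b0, t), P (s q.1 q.2).
        by apply: cs; apply: open_nbhs_nbhs; split => //; apply: KP; exists t.
      by apply: (@filterS _ _ (nbhs_filter (b0, t))) => q; right.
    exists (setT, ~` K); last by move=> [b t'] [_ /= ?]; left.
    split; first exact: filterT.
    by apply: open_nbhs_nbhs; split => //; exact: closed_openC.
  by apply: (@filterS _ _ (nbhs_filter b0)) => b bP _ [t Kt <-]; have [|] := bP t.
have /cF : nbhs (F b0) Q by exact: open_nbhs_nbhs.
by apply: (@filterS _ _ (nbhs_filter b0)) => b /= ?; exact: QA.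
Qed.

End unit_interval_type.

(** * From motion planners to compressions *)

(** Shrinks a cover without changing its size: the finitely many bumps around points are grouped by
    the cover member assigned to their centre, and each group is replaced by its maximum. *)
Lemma open_cover_bumps (R : realType) (B : topologicalType) (n : nat)
    (U : 'I_n -> set B) : hausdorff_space B -> compact [set: B] ->
  (forall i, open (U i)) -> (forall z, exists i, U i z) ->
  exists f : 'I_n -> B -> R, [/\ forall i, continuous (f i),
    forall i z, ~ U i z -> f i z = 0 & forall z, exists i, 2 / 3 < f i z].
Proof.
move=> hB cB oU /choice[idx Uidx].
have bump (z : B) : exists f : B -> R, [/\ continuous f, f z = 1 &
    forall y, ~ U (idx z) y -> f y = 0].
  have [||f [cf f1 f0]] := @urysohn_bump R B [set z] _ hB cB _ (oU (idx z)).
  - exact/accessible_closed_set1/hausdorff_accessible.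
  - by move=> _ ->.
  by exists f; split=> //; exact: f1.
have [g gP] := choice bump.
have nz z : nbhs z [set y | 2 / 3 < g z y].
  by have [cg g1 _] := gP z; apply: (cvgr_gt _ (cg z)); rewrite g1; lra.
have [bs bsP] := compact_finite_cover cB nz.
pose F i l z := foldr (fun y w => Num.max (g y z) w) (0 : R)
  [seq y <- l | idx y == i].
exists (fun i => F i bs); split.
- move=> i; rewrite /F; elim: [seq y <- bs | idx y == i] => [|y l IH] /=.
    by move=> z; exact: cvg_cst.
  by apply: maxr_continuous => //; have [] := gP y.
- move=> i z nUz; rewrite /F.
  have : all (fun y => idx y == i) [seq y <- bs | idx y == i] by exact: filter_all.
  elim: [seq y <- bs | idx y == i] => //= y l IH /andP[/eqP yi /IH ->].
  by have [_ _ ->] := gP y; rewrite ?yi// maxxx.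
- move=> z; have [y ybs gy] := bsP z; exists (idx y).
  have : y \in [seq y' <- bs | idx y' == idx y] by rewrite mem_filter eqxx.
  rewrite /F; elim: [seq _ <- _ | _] => //= y' l IH; rewrite inE lt_max.
  by move=> /orP[/eqP<-|/IH ->]; rewrite ?orbT// gy.
Qed.

Section lift_motion.
Variables (R : realType) (G : topGroupType) (X : gspace G).
Hypothesis lieG : compact_lie_group R G.
Hypothesis cX : compact [set: X].
Hypothesis metX : metrizable R X.
Hypothesis freeX : free_action X.
Local Notation Y := (orbit_space X).
Local Notation pi := (@orbit_proj G X).
Local Notation I := (I_type R).

Definition proj2 (z : X * X) : Y * Y := (pi z.1, pi z.2).

Lemma proj2_continuous : continuous proj2.
Proof.
move=> z.
apply: (@pair_continuous_at _ _ _ (fun z : X * X => pi z.1) (fun z => pi z.2)).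
  apply: (@continuous_comp _ _ _ fst pi); first exact: cvg_fst.
  exact: orbit_proj_continuous.
apply: (@continuous_comp _ _ _ snd pi); first exact: cvg_snd.
exact: orbit_proj_continuous.
Qed.

Lemma proj2_act (g : G * G) (z : X * X) :
  proj2 (act g (z : sq_gspace X)) = proj2 z.
Proof. by rewrite /proj2 /= !orbit_proj_act. Qed.

Lemma proj2P (z z' : X * X) : proj2 z = proj2 z' ->
  exists g : G * G, act g (z : sq_gspace X) = z'.
Proof.
case: z z' => [x y] [x' y'] [/orbit_projP[g <-] /orbit_projP[k <-]].
by exists (g, k).
Qed.

Lemma dalethP (z : X * X) : daleth X z <-> pi z.1 = pi z.2.
Proof.
split=> [[[g k] [[a b] /= -> ->]] /=|]; first by rewrite !orbit_proj_act.
case: z => x y /= /orbit_projP[g gx].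
by exists (1%g, g), (x, x) => //=; rewrite /sq_act/= act1 gx.
Qed.

Let orbit_sep : real_separated R Y.
Proof. by apply: orbit_space_separated metX; case: lieG. Qed.

(** The motion of the first coordinate is lifted to [X], the second coordinate is kept. Where
    [2 / 3 < f] the motion is run to its end, so the lift arrives in the orbit of the second
    coordinate. *)
Lemma motion_compressible (U : set (Y * Y)) (s : Y * Y -> path_space R Y)
    (f : Y * Y -> R) :
  open U -> {within U, continuous s} ->
  (forall b, U b -> path_ends (s b) = b) ->
  continuous f -> (forall b, ~ U b -> f b = 0) ->
  @compressible R (G * G)%type (sq_gspace X) (daleth X)
    (proj2 @^-1` [set b | 2 / 3 < f b]).
Proof.
move=> oU cs ends cf f0.
have {}cs b : U b -> {for b, continuous s}.
  by move: cs; rewrite continuous_open_subspace// => cs /mem_set; exact: cs.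
pose e b := clamp (3 * f b - 1).
have ce : continuous e.
  move=> b; apply: (@continuous_comp _ _ _ (fun b => 3 * f b - 1));
    last exact: clamp_continuous.
  apply: (@cvgB _ R^o); last exact: cvg_cst.
  by apply: cvgM; [exact: cvg_cst|exact: cf].
(* The cutoff [e] slows the motion [s] down to make it total. *)
pose k (q : Y * Y * R) : Y :=
  if `[< U q.1 >] then s q.1 (to_I (e q.1 * q.2)) else q.1.1.
have k0 b t : e b * t = 0 -> k (b, t) = b.1.
  move=> et; rewrite /k /=; case: asboolP => // /ends sb.
  by rewrite et to_I0// -[in RHS]sb.
have ck : continuous k.
  (* Where [f < 1 / 3] the cutoff vanishes and [k] is the first projection; the remaining points lie
     in the open set [U]. *)
  move=> [b t]; have [fb|fb] := ltP (f b) (1 / 3).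
    apply: (near_eq_continuous (g := fun q => q.1.1)); last first.
      by apply: (@continuous_comp _ _ _ fst fst); exact: cvg_fst.
    have nf : \forall b' \near b, f b' < 1 / 3 by apply: (cvgr_lt _ (cf b)).
    exists ([set b' | f b' < 1 / 3], setT); first by split => //; exact: filterT.
    move=> [b' t'] [/= fb' _]; apply: k0.
    by rewrite /e clamp0 ?mul0r//; lra.
  have Ub : U b by apply: contrapT => /f0 fb0; lra.
  apply: (near_eq_continuous (g := fun q => s q.1 (to_I (e q.1 * q.2)))).
    exists (U, setT); first by split; [exact: open_nbhs_nbhs|exact: filterT].
    by move=> [b' t'] [/= Ub' _]; rewrite /k asboolT.
  apply: (@continuous_comp _ _ _
    (fun q : Y * Y * R => (q.1, to_I (e q.1 * q.2)))
    (fun q : Y * Y * I => s q.1 q.2)); last exact/path_eval_continuous/cs.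
  apply: pair_continuous_at; first exact: cvg_fst.
  apply: (@continuous_comp _ _ _ (fun q : Y * Y * R => e q.1 * q.2) (@to_I R));
    last exact: to_I_continuous.
  apply: cvgM; last exact: cvg_snd.
  by apply: (@continuous_comp _ _ _ fst e); [exact: cvg_fst|exact: ce].
(* The homotopy parameter is part of the base, and [h] rescales time by it. One lift at time 1 thus
   gives the whole homotopy, and at parameter 0 the motion is stationary, so the lift there is
   [c0]. *)
pose B : topologicalType := (Y * Y * I)%type.
pose S : topologicalType := (X * X * I)%type.
pose p (q : S) : B := (proj2 q.1, q.2).
pose h (q : B * R) : Y := k (q.1.1, I_val q.1.2 * q.2).
have cY : compact [set: Y] by exact: compact_orbit_space.
have cB : compact [set: B].
  rewrite /B -!setXTT; apply: compact_setX; last exact: I_compact.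
  exact: compact_setX.
have hB : hausdorff_space B.
  apply: (@real_separated_hausdorff R).
  apply: real_separated_prod; last exact: I_separated.
  exact: real_separated_prod.
have cp : continuous p.
  move=> q; apply: (@pair_continuous_at _ _ _ (fun q : S => proj2 q.1) snd);
    last exact: cvg_snd.
  apply: (@continuous_comp _ _ _ fst proj2); first exact: cvg_fst.
  exact: proj2_continuous.
have ch : continuous h.
  move=> q; apply: (@continuous_comp _ _ _
    (fun q : B * R => (q.1.1, I_val q.1.2 * q.2)) k); last exact: ck.
  apply: pair_continuous_at.
    by apply: (@continuous_comp _ _ _ fst fst); exact: cvg_fst.
  apply: cvgM; last exact: cvg_snd.
  apply: (@continuous_comp _ _ _ (fun q : B * R => q.1.2) (@I_val R));
    last exact: I_val_continuous.
  by apply: (@continuous_comp _ _ _ fst snd); [exact: cvg_fst|exact: cvg_snd].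
pose c0 (q : S) : X := q.1.1.
have cc0 : continuous c0.
  by move=> q; apply: (@continuous_comp _ _ _ fst fst); exact: cvg_fst.
have c0E q : pi (c0 q) = h (p q, 0) by rewrite /h k0// !mulr0.
have [c [cc pic cfix cequi]] :=
  lift_transport lieG metX freeX hB cB cp ch cc0 c0E.
pose H (q : X * X * I) : X * X := (c q, q.1.2).
have cH : continuous H.
  move=> q; apply: (@pair_continuous_at _ _ _ c (fun q : S => q.1.2)).
    exact: cc.
  by apply: (@continuous_comp _ _ _ fst snd); [exact: cvg_fst|exact: cvg_snd].
have HI (t : I) : continuous (fun z => H (z, t)).
  move=> z; apply: (@continuous_comp _ _ _ (fun z => (z, t)) H); last exact: cH.
  by apply: pair_continuous_at; [exact: cvg_id|exact: cst_continuous].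
have eqH (t : I) (g : G * G) (z : X * X) :
    H (act g (z : sq_gspace X), t) = act g (H (z, t) : sq_gspace X).
  case: g z => [g g'] [x y]; rewrite /H /= /sq_act /=; congr (_, _).
  by apply: cequi => //; rewrite /p /= /proj2/= !orbit_proj_act.
exists (fun z => H (z, I1 R)); split.
- exact/continuous_subspaceT/HI.
- by move=> g z _; exact: eqH.
- move=> _ [z /= fz <-]; apply/dalethP => /=.
  rewrite pic /h /= mulr1 /k/=; case: asboolP => [Uz|nUz]; last first.
    by exfalso; move: fz; rewrite f0//; lra.
  have e1 : e (proj2 z) = 1 by rewrite /e clamp1//; lra.
  have I11 : I_val (I1 R) = 1 by [].
  by rewrite e1 I11 mulr1 to_I1//; exact: (congr1 snd (ends _ Uz)).
- exists H; split=> //.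
  + exact: continuous_subspaceT.
  + move=> [x y] _; rewrite /H/=; congr (_, _).
    have I00 : I_val (I0 R) = 0 by [].
    by rewrite cfix// => t; rewrite /h/= I00 !mul0r.
  + by move=> t g z _; exact: eqH.
Qed.

(** The cover is shrunk first because lifting uses a homotopy defined over the whole compact base,
    while each planner is controlled only on its [U i]. *)
Lemma invariant_cover_of_motion_cover n :
  (exists U : 'I_n -> set (Y * Y), \bigcup_i U i = [set: Y * Y] /\
    forall i, open (U i) /\ exists s : Y * Y -> path_space R Y,
      {within U i, continuous s} /\ forall p, U i p -> path_ends (s p) = p) ->
  exists U : 'I_n -> set (sq_gspace X), \bigcup_i U i = [set: sq_gspace X] /\
    forall i, [/\ open (U i), invariant_set (U i) &
                  compressible R (daleth X) (U i)].
Proof.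
move=> [U [covU UP]].
have [||i|z|f [cf f0 fcov]] := @open_cover_bumps R (Y * Y)%type n U.
- by apply: (@real_separated_hausdorff R); exact: real_separated_prod.
- by rewrite -setXTT; apply: compact_setX; exact: compact_orbit_space.
- by have [] := UP i.
- have : (\bigcup_i U i) z by rewrite covU.
  by move=> [i _ Uz]; exists i.
exists (fun i => proj2 @^-1` [set b | 2 / 3 < f i b]); split.
  apply/seteqP; split=> // z _; have [i fi] := fcov (proj2 z).
  by exists i.
move=> i; split.
- apply: open_comp; first by move=> z _; exact: proj2_continuous.
  apply: (@open_comp _ _ (f i) [set y | 2 / 3 < y]); last exact: open_gt.
  by move=> b _; exact: cf.
- by move=> g z /=; rewrite -/(proj2 _) (proj2_act g z).
- have [oU [s [cs ends]]] := UP i.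
  exact: motion_compressible cs ends (cf i) (f0 i).
Qed.

End lift_motion.

(** No regularity of [b] enters: near [x] both branches are close to the common value. *)
Lemma if_continuous_at (T U : topologicalType) (b : pred T) (f g : T -> U) x :
  {for x, continuous f} -> {for x, continuous g} -> f x = g x ->
  {for x, continuous (fun y => if b y then f y else g y)}.
Proof.
move=> cf cg fg A; rewrite /= fun_if -fg if_same => nA.
have nf : \forall y \near x, A (f y) by exact: cf.
have ng : \forall y \near x, A (g y) by apply: cg; rewrite /= -fg.
suff : \forall y \near x, A (if b y then f y else g y) by [].
by near=> y; case: ifP => _; near: y.
Unshelve. all: by end_near. Qed.

(** * From compressions to motion planners *)

Section push_forward.
Variables (R : realType) (G : topGroupType) (X : gspace G).
Local Notation Y := (orbit_space X).
Local Notation pi := (@orbit_proj G X).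
Local Notation I := (I_type R).

Lemma proj2_nbhs (z : X * X) (A : set (X * X)) :
  nbhs z A -> nbhs (proj2 z) (@proj2 G X @` A).
Proof.
case: z => x y [[P Q] [/= nP nQ] PQ].
exists (pi @` P, pi @` Q); first by split; exact: orbit_proj_nbhs.
move=> [_ _] [/= [x' Px' <-] [y' Qy' <-]].
by exists (x', y') => //; exact: (PQ (x', y')).
Qed.

Lemma proj2_surj (b : Y * Y) : exists z, @proj2 G X z = b.
Proof.
case: b => b1 b2; have [x <-] := orbit_proj_surj b1.
by have [y <-] := orbit_proj_surj b2; exists (x, y).
Qed.

(** The path follows the projected first coordinate of the compression, then the projected second
    one backwards. They meet at time [1 / 2] because the compressed point lies in [daleth X]. *)
Lemma compressible_motion (U : set (sq_gspace X)) :
  open U -> invariant_set U -> compressible R (daleth X) U ->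
  open (@proj2 G X @` U) /\ exists s : Y * Y -> path_space R Y,
    {within @proj2 G X @` U, continuous s} /\
    forall b, (@proj2 G X @` U) b -> path_ends (s b) = b.
Proof.
move=> oU invU [c [_ _ cU [H [cH H0 H1 eqH]]]].
have oV : open (@proj2 G X @` U).
  rewrite openE => _ [z Uz <-]; apply: proj2_nbhs; exact: open_nbhs_nbhs.
have {}cH z t : U z -> {for (z, t), continuous H}.
  have oUT : open (U `*` [set: I]).
    rewrite openE => -[z' t'] [/= Uz' _]; exists (U, setT) => //.
    by split; [exact: open_nbhs_nbhs|exact: filterT].
  move: cH; rewrite continuous_open_subspace// => cH Uz.
  by apply: cH; apply/mem_set.
pose k (q : X * X * R) : Y := if q.2 <= 1 / 2
  then pi (H (q.1, to_I (2 * q.2))).1 else pi (H (q.1, to_I (2 - 2 * q.2))).2.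
have kinv g z t : U z -> k (act g (z : sq_gspace X), t) = k (z, t).
  by move=> Uz; rewrite /k/= !eqH//= !orbit_proj_act.
have ck z t : U z -> {for (z, t), continuous k}.
  move=> Uz.
  have cpiece (pr : X * X -> X) (a : R -> R) : continuous pr -> continuous a ->
      {for (z, t), continuous
        (fun q : X * X * R => pi (pr (H (q.1, to_I (a q.2)))))}.
    move=> cpr ca; apply: (@continuous_comp _ _ _
      (fun q : X * X * R => H (q.1, to_I (a q.2))) (pi \o pr)); last first.
      apply: continuous_comp; first exact: cpr.
      exact: orbit_proj_continuous.
    apply: (@continuous_comp _ _ _
      (fun q : X * X * R => (q.1, to_I (a q.2))) H); last exact: cH.
    apply: pair_continuous_at; first exact: cvg_fst.
    apply: (@continuous_comp _ _ _ (fun q : X * X * R => a q.2) (@to_I R));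
      last exact: to_I_continuous.
    by apply: (@continuous_comp _ _ _ snd a); [exact: cvg_snd|exact: ca].
  have cmul : continuous (fun t : R => 2 * t).
    by move=> x; apply: cvgM; [exact: cvg_cst|exact: cvg_id].
  have csub : continuous (fun t : R => 2 - 2 * t).
    by move=> x; apply: (@cvgB _ R^o); [exact: cvg_cst|exact: cmul].
  have cfst : continuous (@fst X X) by move=> x; exact: cvg_fst.
  have csnd : continuous (@snd X X) by move=> x; exact: cvg_snd.
  have c1 := cpiece fst _ cfst cmul; have c2 := cpiece snd _ csnd csub.
  have [tlt|tgt|t12] := ltgtP t (1 / 2).
  - apply: near_eq_continuous c1.
    exists (setT, [set t | t < 1 / 2]).
      by split; [exact: filterT|exact: lt_nbhsl].
    by move=> [z' t'] [_ /= /ltW t'lt]; rewrite /k /= t'lt.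
  - apply: near_eq_continuous c2.
    exists (setT, [set t | 1 / 2 < t]).
      by split; [exact: filterT|exact: lt_nbhsr].
    by move=> [z' t'] [_ /= t'gt]; rewrite /k /= leNgt t'gt.
  - apply: (@if_continuous_at _ _ (fun q : X * X * R => q.2 <= 1 / 2) _ _ _ c1 c2).
    rewrite /= !to_I1; [|rewrite t12; lra..].
    by apply/dalethP/cU; exists z => //; exact/esym/H1.
(* An arbitrary, discontinuous choice of lifts is enough: [k] is invariant, so near any point it can
   be replaced by the continuous expression in [z]. *)
have /choice[lift liftK] := proj2_surj.
have Ulift b : (@proj2 G X @` U) b -> U (lift b).
  move=> [z Uz zb]; have [g <-] : exists g : G * G,
      act g (z : sq_gspace X) = lift b by apply: proj2P; rewrite liftK.
  exact: invU.
have klift z t : U z -> k (lift (proj2 z), t) = k (z, t).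
  move=> Uz; have [g <-] : exists g : G * G,
      act g (z : sq_gspace X) = lift (proj2 z) by apply: proj2P; rewrite liftK.
  exact: kinv.
have expath (b : Y * Y) : exists gam : path_space R Y,
    (@proj2 G X @` U) b -> forall t : I, gam t = k (lift b, I_val t).
  have [Ub|nUb] := pselect ((@proj2 G X @` U) b).
    have cgam : continuous (fun t : I => k (lift b, I_val t)).
      move=> t; apply: (@continuous_comp _ _ _
        (fun t : I => (lift b, I_val t)) k); last exact/ck/Ulift.
      apply: pair_continuous_at; first exact: cst_continuous.
      exact: I_val_continuous.
    by exists ([the continuousType I Y of mkcts cgam] : path_space R Y).
  (* A default value outside the image of [U]. *)
  by exists ([the continuousType I Y of mkcts (@cst_continuous I Y b.1)]
    : path_space R Y).
have [s sP] := choice expath.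
split=> //; exists s; split.
  rewrite continuous_open_subspace// => _ /set_mem[z Uz <-].
  apply: path_curry_continuous => t A.
  rewrite /= sP; last by exists z.
  rewrite klift// => nA.
  have cmap : {for (z, t), continuous (fun q : X * X * I => k (q.1, I_val q.2))}.
    apply: (@continuous_comp _ _ _
      (fun q : X * X * I => (q.1, I_val q.2)) k); last exact: ck.
    apply: pair_continuous_at; first exact: cvg_fst.
    apply: (@continuous_comp _ _ _ snd (@I_val R)); first exact: cvg_snd.
    exact: I_val_continuous.
  have [[P Q] [/= nP nQ] PQ] := cmap _ nA.
  have nPU : nbhs z (P `&` U) by apply: filterI => //; exact: open_nbhs_nbhs.
  (* Continuity is proved upstairs and descends because [proj2] is open. *)
  exists (@proj2 G X @` (P `&` U), Q); first by split=> //; exact: proj2_nbhs.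
  move=> [_ t'] [/= [z' [Pz' Uz'] <-] Qt'].
  rewrite sP; last by exists z'.
  by rewrite klift//; exact: (PQ (z', t')).
move=> b Ub; have Ul := Ulift _ Ub; rewrite -[RHS](liftK b).
rewrite /path_ends !sP//; congr (_, _).
- have -> : I_val (I0 R) = 0 by [].
  rewrite /k /= ifT; last by lra.
  by rewrite mulr0 to_I0// H0.
- have -> : I_val (I1 R) = 1 by [].
  rewrite /k /= leNgt ifF; last by apply/negbF; lra.
  by rewrite mulr1 subrr to_I0// H0.
Qed.

Lemma motion_cover_of_invariant_cover n :
  (exists U : 'I_n -> set (sq_gspace X), \bigcup_i U i = [set: sq_gspace X] /\
    forall i, [/\ open (U i), invariant_set (U i) &
                  compressible R (daleth X) (U i)]) ->
  exists U : 'I_n -> set (Y * Y), \bigcup_i U i = [set: Y * Y] /\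
    forall i, open (U i) /\ exists s : Y * Y -> path_space R Y,
      {within U i, continuous s} /\ forall p, U i p -> path_ends (s p) = p.
Proof.
move=> [U [covU UP]]; exists (fun i => @proj2 G X @` U i); split.
  apply/seteqP; split=> // b _; have [z <-] := proj2_surj b.
  have [i _ Uz] : (\bigcup_i U i) z by rewrite covU.
  by exists i => //; exists z.
by move=> i; have [oU invU cU] := UP i; exact: compressible_motion.
Qed.

End push_forward.

Theorem theorem3p10 (R : realType) (G : topGroupType) (X : gspace G) :
  compact_lie_group R G ->
  compact [set: X]%classic ->
  is_GANR R X ->
  free_action X ->
  TC R (orbit_space X) = TC_inv R X.
Proof.
(* The two sets of admissible [n] coincide, so the infinite case needs no separate treatment. *)
move=> lieG cX [metX _] freeX; congr least; apply/seteqP; split=> n /=.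
  exact: invariant_cover_of_motion_cover.
exact: motion_cover_of_invariant_cover.
Qed.
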